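(* Let $\kappa$ be a cardinal of uncountable cofinality. If $X$ is a Banach space of density $\kappa$ which contains an isomorphic copy of $\ell_1(\kappa)$, then $X$ does not admit an overcomplete set. Consequently the following Banach spaces do not admit overcomplete sets: (1) $C(K)$ for any infinite extremally disconnected compact Hausdorff space $K$; (2) $\ell_\infty(\lambda)$, $\ell_\infty(\lambda)/c_0(\lambda)$ and $L_\infty(\{0,1\}^\lambda)$ for any infinite cardinal $\lambda$; (3) $C([0,1]^\kappa)$ and $C(\{0,1\}^\kappa)$.
   Context: All Banach spaces are infinite dimensional and over the reals. $dens(X)$ (the density) is the minimal cardinality of a norm dense subset of $X$. A subset $Y$ of a Banach space $X$ is called overcomplete (in $X$) if $|Y|=dens(X)$ and every $Z\subseteq Y$ with $|Z|=|Y|$ is linearly dense in $X$ (its linear span is norm dense in $X$). $C(K)$ is the space of real-valued continuous functions on $K$ with the supremum norm. $L_\infty(\{0,1\}^\lambda)$ means $L_\infty(\mu)$ for $\mu$ the homogeneous probability product measure on $\{0,1\}^\lambda$. *)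

(* Defs.v *)
From HB Require Import structures.
From mathcomp Require Import all_boot all_order all_algebra.
From mathcomp Require Import generic_quotient ring_quotient.
From mathcomp Require finmap wochoice.
From mathcomp Require Import all_classical all_reals all_analysis ess_sup_inf.
Set Implicit Arguments.
Unset Strict Implicit.
Unset Printing Implicit Defensive.

Import Order.TTheory GRing.Theory Num.Def Num.Theory.
Import numFieldNormedType.Exports.

Local Open Scope classical_set_scope.
Local Open Scope ring_scope.

Section sup_norm.
Context {R : realType} {I : Type}.
Implicit Types f g : I -> R.

Definition bounded_fct f := exists M, forall i, `|f i| <= M.

(* This is 0 when I is empty, since sup set0 = 0. *)
Definition sup_norm f : R := sup (range (fun i => `|f i|)).

Lemma sup_norm_ub f i : bounded_fct f -> `|f i| <= sup_norm f.
Proof.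
move=> [M fM]; apply: ub_le_sup; last by exists i.
by exists M => _ [j _ <-].
Qed.

Lemma sup_norm_le f M : 0 <= M -> (forall i, `|f i| <= M) -> sup_norm f <= M.
Proof.
move=> M0 fM; rewrite /sup_norm; have [->|/set0P ne] := eqVneq (range (fun i => `|f i|)) set0.
  by rewrite sup0.
by apply: ge_sup => // _ [j _ <-].
Qed.

Lemma sup_norm_ge0 f : bounded_fct f -> 0 <= sup_norm f.
Proof.
move=> bf; rewrite /sup_norm; have [->|/set0P[_ [i _ _]]] := eqVneq (range (fun i => `|f i|)) set0.
  by rewrite sup0.
exact: le_trans (sup_norm_ub i bf).
Qed.

Lemma sup_normD f g : bounded_fct f -> bounded_fct g ->
  sup_norm (f + g) <= sup_norm f + sup_norm g.
Proof.
move=> bf bg; apply: sup_norm_le; first by rewrite addr_ge0// sup_norm_ge0.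
by move=> i; rewrite (le_trans (ler_normD _ _))// lerD// sup_norm_ub.
Qed.

Lemma bounded_fct0 : bounded_fct (0 : I -> R).
Proof. by exists 0 => i; rewrite normr0. Qed.

Lemma bounded_fctD f g : bounded_fct f -> bounded_fct g -> bounded_fct (f + g).
Proof.
move=> [M fM] [N gN]; exists (M + N) => i.
by rewrite (le_trans (ler_normD _ _))// lerD.
Qed.

Lemma bounded_fctZ (a : R) f : bounded_fct f -> bounded_fct (a *: f).
Proof.
move=> [M fM]; exists (`|a| * M) => i.
by rewrite [(a *: f) i]/(a * f i) normrM ler_wpM2l.
Qed.

Lemma sup_normZ (a : R) f : bounded_fct f -> sup_norm (a *: f) = `|a| * sup_norm f.
Proof.
move=> bf; apply/eqP; rewrite eq_le; apply/andP; split.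
  apply: sup_norm_le; first by rewrite mulr_ge0// sup_norm_ge0.
  by move=> i; rewrite [(a *: f) i]/(a * f i) normrM ler_wpM2l// sup_norm_ub.
have [->|a0] := eqVneq a 0.
  by rewrite normr0 mul0r sup_norm_ge0//; apply: bounded_fctZ.
rewrite -ler_pdivlMl ?normr_gt0//.
apply: sup_norm_le => [|i].
  by rewrite mulr_ge0 ?invr_ge0// sup_norm_ge0//; apply: bounded_fctZ.
rewrite ler_pdivlMl ?normr_gt0// -normrM -[a * f i]/((a *: f) i).
by rewrite sup_norm_ub//; exact: bounded_fctZ.
Qed.

Lemma sup_norm_eq0 f : bounded_fct f -> sup_norm f = 0 -> f = 0.
Proof.
move=> bf f0; apply/funext => i; apply/eqP; rewrite -normr_eq0.
by rewrite eq_le normr_ge0 andbT -f0 sup_norm_ub.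
Qed.

End sup_norm.

Section continuous_space.
Context (R : realType) (K : topologicalType).

Definition continuous_pred : {pred K -> R} := fun f => `[< continuous f >].

Lemma continuous_submod : submod_closed continuous_pred.
Proof.
split; first by apply/asboolP => x; exact: cvg_cst.
move=> a f g /asboolP cf /asboolP cg; apply/asboolP => x.
by apply: cvgD; [apply: cvgZl_tmp; exact: cf|exact: cg].
Qed.

HB.instance Definition _ :=
  GRing.isSubmodClosed.Build R (K -> R) continuous_pred continuous_submod.

Lemma continuous_bounded (f : K -> R) : compact [set: K] -> continuous f ->
  bounded_fct f.
Proof.
move=> cK cf; have : compact (range f).
  by apply: continuous_compact => //; exact/continuous_subspaceT.
move=> /compact_bounded[M [_ /(_ (M + 1))]].
by rewrite ltrDl ltr01 => /(_ isT) fM; exists (M + 1) => i; apply: fM; exists i.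
Qed.

(* Compactness is what makes the supremum norm finite, so the space is indexed
   by a proof of it. *)
Definition cspace of compact [set: K] : Type :=
  {f : K -> R | f \in continuous_pred}.

Context (cK : compact [set: K]).

HB.instance Definition _ := SubType.copy (cspace cK) {f | f \in continuous_pred}.
HB.instance Definition _ := [Choice of cspace cK by <:].
HB.instance Definition _ := [SubChoice_isSubLmodule of cspace cK by <:].

Let bval (f : cspace cK) : bounded_fct (val f).
Proof. by apply: continuous_bounded => //; apply/asboolP; exact: (valP f). Qed.

Let cspace_norm (f : cspace cK) : R := sup_norm (val f).

Let cspace_normD f g : cspace_norm (f + g) <= cspace_norm f + cspace_norm g.
Proof. exact: sup_normD. Qed.

Let cspace_normZ a f : cspace_norm (a *: f) = `|a| * cspace_norm f.
Proof. exact: sup_normZ. Qed.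

Let cspace_norm_eq0 f : cspace_norm f = 0 -> f = 0.
Proof. by move=> f0; apply: val_inj; exact: sup_norm_eq0. Qed.

HB.instance Definition _ := Lmodule_isNormed.Build R (cspace cK)
  cspace_normD cspace_normZ cspace_norm_eq0.

Lemma cspace_normE (f : cspace cK) : `|f| = sup_norm (val f).
Proof. by []. Qed.

End continuous_space.
Arguments cspace R {K} cK.

Section linf.
Context (R : realType) (I : Type).

Definition linf_pred : {pred I -> R} := fun f => `[< bounded_fct f >].

Lemma linf_submod : submod_closed linf_pred.
Proof.
split; first exact/asboolP/bounded_fct0.
move=> a f g /asboolP bf /asboolP bg; apply/asboolP.
by apply: bounded_fctD => //; exact: bounded_fctZ.
Qed.

HB.instance Definition _ :=
  GRing.isSubmodClosed.Build R (I -> R) linf_pred linf_submod.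

Definition linf : Type := {f : I -> R | f \in linf_pred}.

HB.instance Definition _ := SubType.copy linf {f | f \in linf_pred}.
HB.instance Definition _ := [Choice of linf by <:].
HB.instance Definition _ := [SubChoice_isSubLmodule of linf by <:].

Lemma linf_bounded (f : linf) : bounded_fct (val f).
Proof. by apply/asboolP; exact: (valP f). Qed.

Let linf_norm (f : linf) : R := sup_norm (val f).

Let linf_normD f g : linf_norm (f + g) <= linf_norm f + linf_norm g.
Proof. by apply: sup_normD; exact: linf_bounded. Qed.

Let linf_normZ a f : linf_norm (a *: f) = `|a| * linf_norm f.
Proof. by apply: sup_normZ; exact: linf_bounded. Qed.

Let linf_norm_eq0 f : linf_norm f = 0 -> f = 0.
Proof.
by move=> f0; apply: val_inj; apply: sup_norm_eq0 => //; exact: linf_bounded.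
Qed.

HB.instance Definition _ := Lmodule_isNormed.Build R linf
  linf_normD linf_normZ linf_norm_eq0.

Lemma linf_normE (f : linf) : `|f| = sup_norm (val f).
Proof. by []. Qed.

End linf.

Section l1.
Context (R : realType) (I : choiceType).
Implicit Types f g : I -> R.

Let l1sum f : \bar R := (\esum_(i in [set: I]) `|f i|%:E)%E.

Let l1sum_ge0 f : (0 <= l1sum f)%E.
Proof. by apply: esum_ge0 => i _; rewrite lee_fin. Qed.

Let l1sumD f g : (l1sum (f + g)%R <= l1sum f + l1sum g)%E.
Proof.
rewrite -esumD => [||]; try by move=> i _; rewrite lee_fin.
by apply: le_esum => i _; rewrite -EFinD lee_fin ler_normD.
Qed.

Let l1sumZ_le (a : R) f : (l1sum (a *: f) <= `|a|%:E * l1sum f)%E.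
Proof.
apply: ge_ereal_sup => _ [A [finA _] <-].
under eq_fsbigr do rewrite [X in `|X|]/(a * f _) normrM EFinM.
rewrite -ge0_mule_fsumr; last by move=> i; rewrite lee_fin.
rewrite lee_wpmul2l ?lee_fin//.
by apply: ereal_sup_ubound; exists A.
Qed.

Let l1sumZ (a : R) f : l1sum (a *: f) = (`|a|%:E * l1sum f)%E.
Proof.
apply/eqP; rewrite eq_le l1sumZ_le /=.
have [->|a0] := eqVneq a 0; first by rewrite normr0 mul0e.
rewrite -{1}[f](scalerK a0) -lee_pdivlMl ?normr_gt0// -normfV.
exact: l1sumZ_le.
Qed.

Definition l1_pred : {pred I -> R} :=
  fun f => `[< summable [set: I] (EFin \o f) >].

Let l1_predE f : (f \in l1_pred) = (l1sum f < +oo)%E.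
Proof. by rewrite /l1_pred unfold_in /summable asboolb. Qed.

Lemma l1_submod : submod_closed l1_pred.
Proof.
split.
  rewrite l1_predE (_ : l1sum 0 = 0%E) ?ltry//.
  by apply: esum1 => i _; rewrite normr0.
move=> a f g; rewrite !l1_predE => sf sg.
apply: (le_lt_trans (l1sumD _ _)); apply: lte_add_pinfty => //.
by rewrite l1sumZ lte_mul_pinfty// lee_fin.
Qed.

HB.instance Definition _ :=
  GRing.isSubmodClosed.Build R (I -> R) l1_pred l1_submod.

Definition l1 : Type := {f : I -> R | f \in l1_pred}.

HB.instance Definition _ := SubType.copy l1 {f | f \in l1_pred}.
HB.instance Definition _ := [Choice of l1 by <:].
HB.instance Definition _ := [SubChoice_isSubLmodule of l1 by <:].

Let l1_norm (f : l1) : R := fine (\esum_(i in [set: I]) `|val f i|%:E)%E.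

Let l1_normK (f : l1) : (l1_norm f)%:E = l1sum (val f).
Proof.
have /= := valP f; rewrite l1_predE => lf.
by rewrite fineK// ge0_fin_numE//; exact: l1sum_ge0.
Qed.

Let l1_normD (f g : l1) : l1_norm (f + g) <= l1_norm f + l1_norm g.
Proof. by rewrite -lee_fin EFinD !l1_normK; exact: l1sumD. Qed.

Let l1_normZ a (f : l1) : l1_norm (a *: f) = `|a| * l1_norm f.
Proof. by apply/EFin_inj; rewrite EFinM !l1_normK; exact: l1sumZ. Qed.

Let l1_norm_eq0 (f : l1) : l1_norm f = 0 -> f = 0.
Proof.
move=> f0; apply: val_inj; apply/funext => i; apply/eqP.
rewrite -normr_eq0 eq_le normr_ge0 andbT -lee_fin -[in leRHS]f0 l1_normK.
apply: esum_ge; exists [set i]; first by split => //; exact: finite_set1.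
by rewrite fsbig_set1.
Qed.

HB.instance Definition _ := Lmodule_isNormed.Build R l1
  l1_normD l1_normZ l1_norm_eq0.

Lemma l1_normE (f : l1) : `|f| = fine (\esum_(i in [set: I]) `|val f i|%:E)%E.
Proof. by []. Qed.

End l1.

(* ring_quotient only provides the additive group structure of a quotient. *)
Section lmod_quotient.
Local Open Scope quotient_scope.
Context (R : pzRingType) (V : lmodType R) (W : {pred V}).
Context (Wsub : submod_closed W).

Definition submod_zmodClosed : zmodClosed V :=
  HB.pack (W : V -> bool) (GRing.isZmodClosed.Build V W (GRing.submod_closedB Wsub)).

Definition lmod_quot : Type := Quotient.quot submod_zmodClosed.

HB.instance Definition _ :=
  ZmodQuotient.copy lmod_quot (Quotient.quot submod_zmodClosed).

Lemma lmod_quot_eq (x y : V) :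
  \pi_lmod_quot x = \pi_lmod_quot y <-> x - y \in W.
Proof.
have -> : (x - y \in W) = (\pi_lmod_quot x == \pi_lmod_quot y).
  exact: (Quotient.idealrBE submod_zmodClosed x y).
by split => [->|/eqP].
Qed.

Let scale (a : R) (x : lmod_quot) : lmod_quot := \pi_lmod_quot (a *: repr x).

Lemma repr_lmod_quot (x : V) : repr (\pi_lmod_quot x) - x \in W.
Proof. by apply/lmod_quot_eq; rewrite reprK. Qed.

Let scale_pi a x : scale a (\pi_lmod_quot x) = \pi_lmod_quot (a *: x).
Proof.
apply/lmod_quot_eq; rewrite -scalerBr.
by have [W0 WD] := Wsub; rewrite -[_ *: _]addr0; apply: WD W0; exact: repr_lmod_quot.
Qed.

Let scaleA a b x : scale a (scale b x) = scale (a * b) x.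
Proof. by rewrite -[x]reprK (scale_pi b) (scale_pi a) (scale_pi (a * b)) scalerA. Qed.
Let scale1 : left_id 1 scale.
Proof. by move=> x; rewrite -[x]reprK scale_pi scale1r. Qed.
Let scaleDr : right_distributive scale +%R.
Proof.
move=> a x y; rewrite -[x]reprK -[y]reprK -[X in scale a X]raddfD !scale_pi.
by rewrite scalerDr raddfD.
Qed.
Let scaleDl x : {morph scale^~ x : a b / a + b}.
Proof. by move=> a b; rewrite -[x]reprK !scale_pi scalerDl raddfD. Qed.

HB.instance Definition _ := GRing.Zmodule_isLmodule.Build R lmod_quot
  scaleA scale1 scaleDr scaleDl.

Lemma pi_scale (a : R) (x : V) :
  \pi_lmod_quot (a *: x) = a *: \pi_lmod_quot x.
Proof. by rewrite -scale_pi. Qed.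

End lmod_quotient.

(* A seminorm with kernel W induces a norm on V / W. *)
Section quot_norm.
Local Open Scope quotient_scope.
Context (R : realType) (V : lmodType R) (W : {pred V}).
Context (Wsub : submod_closed W) (p : V -> R).
Hypothesis pD : forall x y, p (x + y) <= p x + p y.
Hypothesis pZ : forall a x, p (a *: x) = `|a| * p x.
Hypothesis pW : forall x, p x = 0 <-> x \in W.

Let Q := lmod_quot Wsub.

Definition quot_norm (x : lmod_quot Wsub) : R := p (repr x).

Lemma quot_norm_pi x : quot_norm (\pi_Q x) = p x.
Proof.
have pB u v : u - v \in W -> p u <= p v.
  by move=> /pW uv0; rewrite -[u](subrK v) (le_trans (pD _ _))// uv0 add0r.
by apply/eqP; rewrite eq_le !pB//; apply/(lmod_quot_eq Wsub); rewrite reprK.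
Qed.

Lemma quot_normD x y : quot_norm (x + y) <= quot_norm x + quot_norm y.
Proof. by rewrite -[x]reprK -[y]reprK -raddfD !quot_norm_pi. Qed.

Lemma quot_normZ a x : quot_norm (a *: x) = `|a| * quot_norm x.
Proof. by rewrite -[x]reprK -pi_scale !quot_norm_pi. Qed.

Lemma quot_norm_eq0 x : quot_norm x = 0 -> x = 0.
Proof.
rewrite -[x]reprK quot_norm_pi => /pW xW.
by rewrite -(raddf0 \pi_Q); apply/lmod_quot_eq; rewrite subr0.
Qed.

End quot_norm.

Section linf_c0.
Context (R : realType) (I : Type).
Local Notation linf := (linf R I).

(* For an arbitrary index set: |f i| < e outside a finite set, for every e. *)
Definition c0_pred : {pred linf} :=
  fun f => `[< forall e : R, 0 < e -> finite_set [set i | e <= `|val f i|] >].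

Lemma c0_submod : submod_closed c0_pred.
Proof.
split.
  apply/asboolP => e e0; rewrite [X in finite_set X](_ : _ = set0)//.
  by apply/seteqP; split => // i /=; rewrite normr0 leNgt e0.
move=> a f g /asboolP cf /asboolP cg; apply/asboolP => e e0.
have a1 : 0 < `|a| + 1 by rewrite ltr_wpDl.
have e20 : 0 < e / 2 / (`|a| + 1) by rewrite !divr_gt0.
have e2 : 0 < e / 2 by rewrite divr_gt0.
apply: sub_finite_set (_ : finite_set ([set i | e / 2 / (`|a| + 1) <= `|val f i|] `|`
  [set i | e / 2 <= `|val g i|])); last by rewrite finite_setU; split; [exact: cf|exact: cg].
move=> i /=; rewrite [X in `|X|]/(a * val f i + val g i) => ei.
apply/orP; rewrite leNgt (leNgt (e / 2)) -negb_and; apply: contraL ei.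
move=> /andP[fi gi]; rewrite -ltNge (le_lt_trans (ler_normD _ _))//.
rewrite [ltRHS](splitr e) ler_ltD// normrM.
rewrite (@le_trans _ _ ((`|a| + 1) * `|val f i|))//.
  by rewrite ler_wpM2r// lerDl.
by rewrite -ler_pdivlMl// mulrC ltW.
Qed.

Definition c0_dist (f : linf) : R := inf [set `|f - g| | g in [set` c0_pred]].

Let c0_dist_lb (f : linf) : has_lbound [set `|f - g| | g in [set` c0_pred]].
Proof. by exists 0 => _ [g _ <-]. Qed.

Let c0_0 : (0 : linf) \in c0_pred. Proof. exact: c0_submod.1. Qed.
Let c0D (f g : linf) : f \in c0_pred -> g \in c0_pred -> f + g \in c0_pred.
Proof. by move=> fc gc; have := c0_submod.2 1 f g fc gc; rewrite scale1r. Qed.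
Let c0Z a (f : linf) : f \in c0_pred -> a *: f \in c0_pred.
Proof. by move=> fc; have := c0_submod.2 a f 0 fc c0_0; rewrite addr0. Qed.

Let c0_dist_le (f g : linf) : g \in c0_pred -> c0_dist f <= `|f - g|.
Proof. by move=> gc; apply: ge_inf => //; exists g. Qed.

Let le_c0_dist (f : linf) M : (forall g, g \in c0_pred -> M <= `|f - g|) ->
  M <= c0_dist f.
Proof.
move=> H; apply: lb_le_inf; first by exists `|f - 0|, 0.
by move=> _ [g gc <-]; exact: H.
Qed.

Let c0_dist_ge0 f : 0 <= c0_dist f.
Proof. exact: le_c0_dist. Qed.

Lemma c0_distD f g : c0_dist (f + g) <= c0_dist f + c0_dist g.
Proof.
rewrite -lerBlDr; apply: le_c0_dist => h hc.
rewrite lerBlDl -lerBlDr; apply: le_c0_dist => k kc.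
rewrite lerBlDl (le_trans (c0_dist_le (f + g) (c0D hc kc)))//.
by rewrite opprD addrACA ler_normD.
Qed.

Let c0_distZ_le a f : c0_dist (a *: f) <= `|a| * c0_dist f.
Proof.
have [->|a0] := eqVneq a 0.
  by rewrite scale0r normr0 mul0r (le_trans (c0_dist_le 0 c0_0))// subrr normr0.
rewrite -ler_pdivrMl ?normr_gt0//; apply: le_c0_dist => g gc.
rewrite ler_pdivrMl ?normr_gt0// -normrZ scalerBr.
exact/c0_dist_le/c0Z.
Qed.

Lemma c0_distZ a f : c0_dist (a *: f) = `|a| * c0_dist f.
Proof.
apply/eqP; rewrite eq_le c0_distZ_le /=.
have [->|a0] := eqVneq a 0; first by rewrite normr0 mul0r.
by rewrite -{1}[f](scalerK a0) -ler_pdivlMl ?normr_gt0// -normfV.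
Qed.

Lemma c0_dist_eq0 f : c0_dist f = 0 <-> f \in c0_pred.
Proof.
split=> [f0|fc]; last first.
  by apply/eqP; rewrite eq_le c0_dist_ge0 andbT (le_trans (c0_dist_le f fc))// subrr normr0.
apply/asboolP => e e0.
have e2 : 0 < e / 2 by rewrite divr_gt0.
have [g gc fg] : exists2 g, g \in c0_pred & `|f - g| < e / 2.
  apply: contrapT => nofg; move: e2; rewrite ltNge -f0; apply/negP/negPn.
  apply: le_c0_dist => g gc; rewrite leNgt; apply/negP => fg.
  by apply: nofg; exists g.
have /asboolP/(_ _ e2) := gc; apply: sub_finite_set => i /= ei.
have : `|val f i - val g i| <= `|f - g|.
  by rewrite linf_normE; exact: (sup_norm_ub i (linf_bounded (f - g))).
move=> /le_lt_trans/(_ fg) fgi; rewrite leNgt; apply/negP => gi.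
move: ei; apply/negP; rewrite -ltNge -[val f i](subrK (val g i)).
by rewrite (le_lt_trans (ler_normD _ _))// [ltRHS](splitr e) ltrD.
Qed.

(* The quotient norm of the class of f is the distance from f to c_0. *)
Definition linf_mod_c0 : Type := lmod_quot c0_submod.

HB.instance Definition _ := GRing.Lmodule.copy linf_mod_c0 (lmod_quot c0_submod).

HB.instance Definition _ := Lmodule_isNormed.Build R linf_mod_c0
  (quot_normD c0_distD c0_dist_eq0) (quot_normZ c0_distD c0_distZ c0_dist_eq0)
  (quot_norm_eq0 c0_distD c0_dist_eq0).

Lemma linf_mod_c0_normE (f : linf) :
  `|\pi_(lmod_quot c0_submod)%qT f : linf_mod_c0| =
  inf [set `|f - g| | g in [set` c0_pred]].
Proof. exact: (quot_norm_pi c0_submod c0_distD c0_dist_eq0). Qed.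

End linf_c0.

Section Linf.
Context d (T : measurableType d) (R : realType).
Context (mu : {measure set T -> \bar R}).
Local Notation Loo := (LfunType mu (leey 1)).

Definition ae0_pred : {pred Loo} := fun f => `[< f = cst 0 %[ae mu] >].

Lemma ae0_submod : submod_closed ae0_pred.
Proof.
split; first by apply/asboolP; exact: ae_eq_refl.
move=> a f g /asboolP f0 /asboolP g0; apply/asboolP.
have E (u v : R) : u = 0 -> v = 0 -> a * u + v = 0.
  by move=> -> ->; rewrite mulr0 addr0.
by apply: filterS2 f0 g0 => x f0 g0 _; exact: E (f0 I) (g0 I).
Qed.

Definition Loo_norm (f : Loo) : R := fine ('N[mu]_+oo [EFin \o f])%E.

Let Loo_normD f g : Loo_norm (f + g) <= Loo_norm f + Loo_norm g.
Proof. exact: ler_LnormD. Qed.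

Let Loo_normZ a f : Loo_norm (a *: f) = `|a| * Loo_norm f.
Proof.
by apply/EFin_inj; rewrite EFinM !finite_norm_fine; exact: LnormZ.
Qed.

Let Loo_norm_eq0 f : Loo_norm f = 0 <-> f \in ae0_pred.
Proof.
split=> [f0|/asboolP f0]; first exact/asboolP/fine_Lnormr_eq0.
rewrite /Loo_norm unlock /Lnorm; case: ifPn => // mu0.
rewrite abs_ess_sup_eq0//.
by apply: filterS f0 => x f0 _ /=; rewrite f0.
Qed.

(* LfunType consists of functions; L_oo(mu) identifies those that are equal
   almost everywhere, with the essential supremum norm. *)
Definition Linf : Type := lmod_quot ae0_submod.

HB.instance Definition _ := GRing.Lmodule.copy Linf (lmod_quot ae0_submod).

HB.instance Definition _ := Lmodule_isNormed.Build R Linf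
  (quot_normD Loo_normD Loo_norm_eq0)
  (quot_normZ Loo_normD Loo_normZ Loo_norm_eq0)
  (quot_norm_eq0 Loo_normD Loo_norm_eq0).

Lemma Linf_normE (f : Loo) :
  `|\pi_(lmod_quot ae0_submod)%qT f : Linf| = fine ('N[mu]_+oo [EFin \o f])%E.
Proof. exact: (quot_norm_pi ae0_submod Loo_normD Loo_norm_eq0). Qed.

End Linf.

Section topology.

Definition extremally_disconnected (K : topologicalType) :=
  forall U : set K, open U -> open (closure U).

Lemma set_type_compact (T : topologicalType) (A : set T) :
  compact A -> compact [set: set_type A].
Proof.
move=> cA F FF _.
have FA : (set_val @ F) A.
  by rewrite /fmap /=; apply: filterS filterT => x _; exact: set_valP.
have [x [Ax Fx]] := cA _ (fmap_proper_filter set_val FF) FA.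
exists (SigSub (mem_set Ax)); split => // B C FB [_ [[U oU <-] /= Ux UC]].
have FB' : (set_val @ F) (set_val @` B).
  by apply: (@filterS _ F _ B) => // y By; exists y.
have [_ [[y By <-] Uy]] := Fx _ _ FB' (open_nbhs_nbhs (conj oU Ux)).
by exists y; split => //; exact: UC.
Qed.

Lemma power_compact (I : choiceType) (T : topologicalType) :
  compact [set: T] -> compact [set: prod_topology (fun _ : I => T)].
Proof.
move=> cT; have := @tychonoff I (fun=> T) (fun=> [set: T]) (fun=> cT).
by congr compact; apply/seteqP; split.
Qed.

End topology.

Definition unit_interval (R : realType) : Type := set_type `[0%R : R, 1%R]%classic.
HB.instance Definition _ (R : realType) := Topological.on (unit_interval R).

Definition tychonoff_cube (R : realType) (I : Type) : Type :=
  prod_topology (fun _ : I => unit_interval R).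
HB.instance Definition _ (R : realType) (I : Type) :=
  Topological.on (tychonoff_cube R I).

Definition cantor_cube (I : Type) : Type := prod_topology (fun _ : I => bool).
HB.instance Definition _ (I : Type) := Topological.on (cantor_cube I).

Lemma tychonoff_cube_compact (R : realType) (I : choiceType) :
  compact [set: tychonoff_cube R I].
Proof. exact/power_compact/set_type_compact/segment_compact. Qed.

Lemma cantor_cube_compact (I : choiceType) : compact [set: cantor_cube I].
Proof. exact/power_compact/bool_compact. Qed.

Arguments tychonoff_cube_compact R I : clear implicits.
Arguments cantor_cube_compact I : clear implicits.

(* The homogeneous product probability on I -> bool. The function coin_avg s f
   averages f over the 2 ^ size s assignments of truth values to the coordinates
   listed in s (for s without duplicates). An event that depends only on the
   coordinates in s is given the average over s of its indicator, and this
   content is then extended to the product sigma-algebra;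
   coin_measure_cylinder computes the result on basic cylinders. *)
Section fair_coin_average.
Context {R : realType} {I : eqType}.
Local Notation T := (I -> bool).
Implicit Types (f g : T -> R) (x y : T) (s : seq I).

Let upd x (i : I) (b : bool) : T := fun j => if j == i then b else x j.

Let avg1 (i : I) f : T -> R := fun x => (f (upd x i true) + f (upd x i false)) / 2.

Fixpoint coin_avg s f : T -> R :=
  if s is i :: s' then coin_avg s' (avg1 i f) else f.

Let updC x i j b c : i != j -> upd (upd x i b) j c = upd (upd x j c) i b.
Proof.
move=> ij; apply/funext => k; rewrite /upd.
by case: eqVneq => [->|//]; rewrite eq_sym (negbTE ij).
Qed.

Let avg1C i j f : avg1 i (avg1 j f) = avg1 j (avg1 i f).
Proof.
have [->//|ij] := eqVneq i j; apply/funext => x; rewrite /avg1.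
by rewrite ![upd (upd x i _) j _]updC// -!mulrDl addrACA.
Qed.

Let avg1_avg i s f : avg1 i (coin_avg s f) = coin_avg s (avg1 i f).
Proof. by elim: s f => //= j s ih f; rewrite ih avg1C. Qed.

Let coin_avgC s t f : coin_avg s (coin_avg t f) = coin_avg t (coin_avg s f).
Proof. by elim: s f => //= i s ih f; rewrite avg1_avg ih. Qed.

Let coin_avg_cst s c : coin_avg s (fun=> c) = fun=> c.
Proof.
elim: s => //= i s ih; rewrite (_ : avg1 i _ = fun=> c)//.
by apply/funext => x; rewrite /avg1 mulrDl -splitr.
Qed.

Lemma coin_avgD s f g : coin_avg s (f \+ g) = coin_avg s f \+ coin_avg s g.
Proof.
elim: s f g => //= i s ih f g; rewrite -ih; congr coin_avg; apply/funext => x.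
by rewrite /avg1 /= -mulrDl addrACA.
Qed.

Lemma coin_avg_ge0 s f x : (forall y, 0 <= f y) -> 0 <= coin_avg s f x.
Proof.
elim: s f x => //= i s ih f x f0; apply: ih => y.
by rewrite divr_ge0// addr_ge0.
Qed.

Definition depends_on {U : Type} s (f : T -> U) :=
  forall x y, {in s, x =1 y} -> f x = f y.

Lemma coin_avg_depends s f x y : depends_on s f -> coin_avg s f x = coin_avg s f y.
Proof.
elim: s f => [|i s ih] f fs /=; first exact: fs.
apply: ih => u v uv; congr (_ / 2); congr (_ + _); apply: fs => j.
  by rewrite inE /upd; case: eqVneq => //= _ js; exact: uv.
by rewrite inE /upd; case: eqVneq => //= _ js; exact: uv.
Qed.

Lemma coin_avg_unique s t f x : depends_on s f -> depends_on t f ->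
  coin_avg s f x = coin_avg t f x.
Proof.
move=> fs ft.
have Es : coin_avg s f = fun=> coin_avg s f x.
  by apply/funext => y; exact: coin_avg_depends.
have Et : coin_avg t f = fun=> coin_avg t f x.
  by apply/funext => y; exact: coin_avg_depends.
have := congr1 (fun h => h x) (coin_avgC s t f).
by rewrite Es Et !coin_avg_cst.
Qed.

Lemma coin_avgZ s (c : R) f : coin_avg s (c \*o f) = c \*o coin_avg s f.
Proof.
elim: s f => //= i s ih f; rewrite -ih; congr coin_avg; apply/funext => x.
by rewrite /avg1 /= -mulrDr mulrA.
Qed.

Lemma coin_avg_cylinder s (a : T) x : uniq s ->
  coin_avg s (\1_[set y : T | {in s, y =1 a}]) x = 2 ^- size s.
Proof.
elim: s => [_|i s ih /= /andP[ns us]].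
  by rewrite expr0 invr1 /= indicE mem_set// => i; rewrite in_nil.
rewrite exprS invfM -(ih us) -[RHS]/((2^-1 \*o coin_avg s _) x) -coin_avgZ.
congr (coin_avg _ _ _); apply/funext => y; rewrite /avg1 /= mulrC; congr (_ * _).
have updP b : (upd y i b \in [set y : T | {in i :: s, y =1 a}]) =
    (b == a i) && (y \in [set y : T | {in s, y =1 a}]).
  apply/idP/andP => [/set_mem ya|[/eqP ba /set_mem ya]].
    split; first by rewrite -(ya i) ?mem_head// /upd eqxx.
    apply/mem_set => j js; rewrite -(ya j) ?inE ?js ?orbT// /upd.
    by case: eqVneq js ns => // -> ->.
  apply/mem_set => j; rewrite inE /upd.
  by case: eqVneq => [-> //|_ /=]; exact: ya.
by rewrite !indicE !updP; case: (a i) => /=; rewrite ?addr0 ?add0r.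
Qed.

End fair_coin_average.

Section cylinder_algebra.
Context (I : choiceType).

(* A copy of the cube carrying the algebra of clopen cylinders. *)
Definition coin_cylinders : Type := cantor_cube I.

HB.instance Definition _ := Topological.on coin_cylinders.
HB.instance Definition _ := isPointed.Build coin_cylinders (fun=> false).

Implicit Types A B : set coin_cylinders.

Definition cylinder : set (set coin_cylinders) :=
  [set A | exists s : seq I, depends_on s A].

Let cylinderT : cylinder [set: coin_cylinders].
Proof. by exists [::]. Qed.

Let cylinderD : setD_closed cylinder.
Proof.
move=> A B [s As] [t Bt]; exists (s ++ t) => x y xy.
rewrite /setD /mkset (As x y) ?(Bt x y)// => i it; apply: xy; rewrite mem_cat it ?orbT//.
Qed.

HB.instance Definition _ := @isAlgebraOfSets_setD.Build
  default_measure_display coin_cylinders cylinder cylinderT cylinderD.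

Lemma cylinder_open A : cylinder A -> open A.
Proof.
move=> [s As]; rewrite openE => x Ax.
have : nbhs x [set y : coin_cylinders | {in s, x =1 y}].
  elim: {As} s => [|i s ih]; first by apply: filterS filterT => y _ j; rewrite in_nil.
  have xi : nbhs x [set y : coin_cylinders | y i = x i].
    apply: (@proj_continuous I (fun=> bool) i x [set x i]).
    by rewrite nbhs_principalE; exact/principal_filterP.
  apply: filterS2 xi ih => y yi ys j; rewrite inE => /predU1P[->//|]; exact: ys.
by apply: filterS => y /As <-.
Qed.

Lemma cylinder_compact A : cylinder A -> compact A.
Proof.
move=> cA; apply: (subclosed_compact _ (cantor_cube_compact I)) => //.
by rewrite -openC -setTD; apply/cylinder_open/cylinderD.
Qed.

End cylinder_algebra.

Section coin_measure.
Context (R : realType) (I : choiceType).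
Local Notation T := (coin_cylinders I).
Implicit Types A B : set T.

Let coin_support A : seq I := xget [::] [set s | depends_on s A].

Definition coin_content A : \bar R :=
  (coin_avg (coin_support A) (\1_A : (I -> bool) -> R) point)%:E.

Let depends_indic s A : depends_on s A -> depends_on s (\1_A : T -> R).
Proof.
by move=> As x y xy; rewrite !indicE; congr (_ _)%:R; apply/idP/idP;
  rewrite !inE (As _ _ xy).
Qed.

Lemma coin_contentE s A : depends_on s A ->
  coin_content A = (coin_avg s (\1_A : (I -> bool) -> R) point)%:E.
Proof.
move=> As; congr EFin; apply: coin_avg_unique; apply: depends_indic => //.
by rewrite /coin_support; case: xgetP => // /(_ s).
Qed.

Let coin_content_ge0 A : (0 <= coin_content A)%E.
Proof. by rewrite lee_fin; apply: coin_avg_ge0 => x; rewrite indicE. Qed.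

Let coin_content0 : coin_content set0 = 0%E.
Proof.
rewrite (@coin_contentE [::])//= indic0//.
Qed.

Let coin_content_additive : measure_function.semi_additive coin_content.
Proof.
apply/additive2P => // A B [s As] [t Bt] AB0.
have dep (C : set T) (u : seq I) : depends_on u C -> {subset u <= s ++ t} -> depends_on (s ++ t) C.
  by move=> Cu ust x y xy; apply: Cu => i iu; apply/xy/ust.
have Ast : depends_on (s ++ t) A.
  by apply: (dep _ s) => // i; rewrite mem_cat => ->.
have Bst : depends_on (s ++ t) B.
  by apply: (dep _ t) => // i; rewrite mem_cat => ->; rewrite orbT.
have ABst : depends_on (s ++ t) (A `|` B).
  by move=> x y xy; rewrite /setU /mkset (Ast _ _ xy) (Bst _ _ xy).
rewrite (coin_contentE Ast) (coin_contentE Bst) (coin_contentE ABst) -EFinD.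
congr EFin; rewrite -[RHS]/((coin_avg _ _ \+ coin_avg _ _) point) -coin_avgD.
congr (coin_avg _ _ _); apply/funext => x /=.
rewrite !indicE in_setU.
have [xA|xA] := boolP (x \in A); have [xB|xB] := boolP (x \in B);
  rewrite ?addr0 ?add0r//.
suff : (A `&` B) x by rewrite AB0.
by split; exact: set_mem.
Qed.

HB.instance Definition _ := isContent.Build _ T R coin_content
  coin_content_ge0 coin_content_additive.

Let coin_content_sigma_subadditive :
  measurable_subset_sigma_subadditive coin_content.
Proof.
move=> A F mF mA AF.
have := cylinder_compact mA; rewrite compact_cover => /(_ nat setT F) [].
- by move=> i _; apply: cylinder_open; exact: mF.
- exact: AF.
move=> D _ AD.
pose n := (\max_(i <- finmap.enum_fset D) i.+1)%N.
have An : A `<=` \big[setU/set0]_(i < n) F i.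
  move=> x /AD[i /= iD Fix]; rewrite -bigcup_mkord; exists i => //=.
  exact: (@leq_bigmax_seq _ (finmap.enum_fset D) xpredT (fun i => i.+1)).
apply: (@le_trans _ _ (\sum_(i < n) coin_content (F i))%E).
  by apply: content_subadditive => // i _; exact: mF.
rewrite -(big_mkord xpredT (fun i => coin_content (F i))).
by apply: nneseries_lim_ge => i _ _; exact: coin_content_ge0.
Qed.

HB.instance Definition _ := Content_SigmaSubAdditive_isMeasure.Build _ R T
  coin_content coin_content_sigma_subadditive.

Definition coin_space := g_sigma_algebraType (@measurable _ T).

HB.instance Definition _ := Measurable.on coin_space.

Definition coin_measure : set coin_space -> \bar R :=
  measure_extension coin_content.

HB.instance Definition _ := Measure.on coin_measure.

Lemma coin_measure_setT : coin_measure [set: coin_space] = 1%E.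
Proof.
rewrite /coin_measure /measure_extension measurable_mu_extE//=.
by rewrite (@coin_contentE [::])//= indicT.
Qed.

Lemma coin_measure_cylinder (s : seq I) (a : I -> bool) : uniq s ->
  coin_measure [set x : I -> bool | {in s, x =1 a}] = (2 ^- size s)%:E.
Proof.
move=> us; have dep : depends_on s [set x : I -> bool | {in s, x =1 a}].
  move=> x y xy; apply/propext; split=> xa i si /=.
    by rewrite -xy// xa.
  by rewrite xy// xa.
rewrite /coin_measure /measure_extension measurable_mu_extE//=; last by exists s.
by rewrite (coin_contentE dep) coin_avg_cylinder.
Qed.

HB.instance Definition _ := Measure_isProbability.Build _ _ R coin_measure
  coin_measure_setT.

End coin_measure.
Arguments coin_measure R I _ : clear implicits.

Section cardinals.
Local Open Scope card_scope.

(* A cardinal is represented by a type of that cardinality. Such an r identifies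
   K with the initial ordinal |K|: a well-order all of whose proper initial
   segments have cardinality less than |K|. *)
Definition initial_well_order (K : Type) (r : rel K) :=
  wochoice.well_order r /\
  forall x, ~ ([set: K] #<= [set y | r y x /\ y <> x]).

Definition cofinal (K : Type) (r : rel K) (A : set K) :=
  forall x, exists2 y, A y & r x y.

(* cf |K| > omega. A finite K has a finite cofinal subset, so this forces K to be
   infinite. *)
Definition uncountable_cofinality (K : Type) :=
  exists2 r : rel K, initial_well_order r &
    forall A : set K, countable A -> ~ cofinal r A.

End cardinals.

Section banach.
Local Open Scope card_scope.
Context {R : realType}.
Implicit Types X E : normedModType R.

Definition lin_span X (Z : set X) : set X :=
  [set v | exists n (a : 'I_n -> R) (z : 'I_n -> X),
     (forall i, Z (z i)) /\ v = \sum_i a i *: z i].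

Definition linearly_dense X (Z : set X) := dense (lin_span Z).

Definition infinite_dimensional X :=
  forall s : seq X, lin_span [set` s] <> [set: X].

(* dens(X) = |A|. *)
Definition has_density X (U : Type) (A : set U) :=
  (exists2 D : set X, dense D & D #= A) /\
  (forall D : set X, dense D -> A #<= D).

Definition overcomplete X (Y : set X) :=
  has_density X Y /\
  forall Z : set X, Z `<=` Y -> Z #= Y -> linearly_dense Z.

Definition admits_overcomplete X := exists Y : set X, overcomplete Y.

(* A linear embedding that is bounded above and below, that is, a linear
   homeomorphism onto its range. *)
Definition contains_copy E X :=
  exists (f : {linear E -> X}) (c C : R),
    0 < c /\ forall x, c * `|x| <= `|f x| <= C * `|x|.

End banach.

Arguments admits_overcomplete {R} X.
Arguments infinite_dimensional {R} X.
Arguments contains_copy {R} E X.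

(* Main.v *)
(* Write c for the continuum, and let Y be overcomplete in X.

   If |Y| = kappa <= c and kappa is not a countable union of smaller sets, then X
   cannot carry functionals of bounded norm that take all 0/1 patterns on a family
   (e_i), i < kappa. Let N be a minimal weak* closed set of functionals that still
   realise all finite patterns. By minimality every vector has small oscillation
   on N once finitely many more signs are prescribed. Since Y spans a dense
   subspace, for each i some y_i in Y must react to the i-th sign: for suitable
   finitely many other signs, y_i <= p on one side and y_i >= q > p on the other.
   As {0,1,2}^kappa is separable (kappa <= c), all these finite conditions and
   rationals fall into countably many classes of mutually compatible data, so
   kappa many i belong to one class. The corresponding y_i are equivalent to a
   basis of l_1, and omitting one of them leaves a subset of Y of full cardinality
   that is not linearly dense. This applies to l_oo, with kappa = c.

   If there is a bounded operator S from X to l_oo with dense range, take W in S(Y)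
   such that every V in W with |V| = |W| has a preimage in Y of full cardinality;
   every such V is linearly dense, so W would be overcomplete in l_oo. Hence such
   an X has no overcomplete set, whatever its density. When kappa >= c a copy of
   l_1(kappa) yields such an operator by the Hahn-Banach theorem; for the concrete
   spaces it is given by point evaluations or by limits along ultrafilters. The
   cubes with kappa < c have density kappa by the lattice Stone-Weierstrass
   theorem and fall under the first case. *)

Require Import Defs.
From mathcomp Require Import all_boot all_order all_algebra.
From mathcomp Require wochoice.
From mathcomp Require Import all_classical all_reals all_analysis.
From mathcomp Require Import measurable_realfun ess_sup_inf ring lra.

Set Implicit Arguments.
Unset Strict Implicit.
Unset Printing Implicit Defensive.

Import Order.TTheory GRing.Theory Num.Def Num.Theory.
Import numFieldNormedType.Exports.

Local Open Scope classical_set_scope.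
Local Open Scope ring_scope.

(** * Cardinals and well-orders *)

Section cardinal_comparison.
Local Open Scope card_scope.

Lemma card_le_injP T U (A : set T) (B : set U) :
  A #<= B <-> exists2 f : A -> U, injective f & forall x, B (f x).
Proof.
split=> [/card_leP[f]|[f fi fB]].
  exists (fun x => val (f x)) => [x y /val_inj|x]; last exact: set_valP.
  by apply: (inj (f := f)); exact: mem_set.
pose g (x : A) : B := SigSub (mem_set (fB x)).
apply/card_leP/injfunPex; exists g => // x y _ _ /(congr1 val).
exact: fi.
Qed.

Lemma card_le_fun T U (A : set T) (B : set U) (f : T -> U) :
  (forall x y, A x -> A y -> f x = f y -> x = y) -> (forall x, A x -> B (f x)) ->
  A #<= B.
Proof.
move=> fi fB; apply/card_le_injP; exists (fun x => f (val x)); last first.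
  by move=> x; apply: fB; exact: set_valP.
by move=> x y /fi xy; apply: val_inj; apply: xy; exact: set_valP.
Qed.

Lemma card_le_funT T U (f : T -> U) : injective f -> [set: T] #<= [set: U].
Proof. by move=> fi; apply: (@card_le_fun _ _ _ _ f) => // x y _ _ /fi. Qed.

Lemma card_leTP T U : [set: T] #<= [set: U] <-> exists f : T -> U, injective f.
Proof.
split=> [/card_le_injP[f fi _]|[f]]; last exact: card_le_funT.
by exists (fun x => f (SigSub (mem_set (I : setT x)))) => x y /fi /(congr1 val).
Qed.

Lemma card_set_type T (A : set T) : [set: A] #= A.
Proof.
apply/card_eqPle; split.
  by apply: (@card_le_fun _ _ _ _ val) => [x y _ _ /val_inj//|x _]; exact: set_valP.
apply/card_le_injP; exists id => //.
Qed.

Lemma card_le_wf T (P : set (set T)) : P !=set0 ->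
  exists2 W, P W & forall V, P V -> W #<= V.
Proof.
move=> [W0 PW0].
have [P0|P0] := pselect (P set0); first by exists set0 => // V _; exact: card_ge0.
have ne V : P V -> V !=set0.
  by move=> PV; apply/set0P/eqP => V0; apply: P0; rewrite -V0.
have [t0 _] := ne _ PW0.
pose Q (F : set (set T -> T)) := (forall g V, F g -> P V -> V (g V)) /\
  (forall g h V, F g -> F h -> P V -> g V = h V -> g = h).
have [C CQ Ctot|F [[F1 F2] Fmax]] := @Zorn_bigcup _ Q.
  split=> [g V [F CF Fg]|g h V [F CF Fg] [G CG Gh]]; first exact: (CQ _ CF).1.
  have [FG|GF] := Ctot _ _ CF CG.
    by apply: (CQ _ CG).2 => //; exact: FG.
  by apply: (CQ _ CF).2 => //; exact: GF.
have [[V [PV Vs]]|noV] := pselect (exists V, P V /\ forall t, V t -> exists2 g, F g & g V = t).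
  exists V => // W PW.
  have ex (t : V) : exists g, F g /\ g V = val t.
    by have [g Fg gt] := Vs _ (set_valP t); exists g.
  have [G GP] := choice ex.
  apply/card_le_injP; exists (fun t => G t W) => [s t st|t].
    apply: val_inj; rewrite -(GP s).2 -(GP t).2.
    by rewrite (F2 _ _ W (GP s).1 (GP t).1 PW st).
  exact: (F1 (G t) W (GP t).1 PW).
exfalso.
have ex V : exists t, P V -> V t /\ forall g, F g -> g V <> t.
  have [PV|] := pselect (P V); last by exists t0.
  apply: contrapT => not; apply: noV; exists V; split => // t Vt.
  apply: contrapT => nog; apply: not; exists t => _; split => // g Fg gV.
  by apply: nog; exists g.
have [h hP] := choice ex.
apply: (Fmax (F `|` [set h])).
  split; first by move=> g; left.
  move=> /(_ h) /(_ (or_intror erefl)) Fh.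
  by have [_ /(_ _ Fh)] := hP _ PW0.
split=> [g V [Fg|->] PV|g k V [Fg|->] [Fk|->] PV //].
- exact: (F1 g V Fg PV).
- by have [] := hP _ PV.
- exact: F2.
- by have [_ /(_ _ Fg)] := hP _ PV.
- by move=> /esym; have [_ /(_ _ Fk)] := hP _ PV.
Qed.

(** Comparability follows from the existence of a least cardinality among the copies of [A] and [B]
    in the disjoint sum. *)
Lemma card_le_total T U (A : set T) (B : set U) : A #<= B \/ B #<= A.
Proof.
have EA : @inl T U @` A #= A by apply: inj_card_eq => x y _ _ [].
have EB : @inr T U @` B #= B by apply: inj_card_eq => x y _ _ [].
have [|W [->|->] H] := @card_le_wf (T + U)%type [set inl @` A; inr @` B].
- by exists (inl @` A); left.
- left; rewrite -(card_le_eql EA) -(card_le_eqr EB).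
  by apply: H; right.
- right; rewrite -(card_le_eql EB) -(card_le_eqr EA).
  by apply: H; left.
Qed.

Lemma card_leNgt T U (A : set T) (B : set U) : ~ (A #<= B) -> B #<= A.
Proof. by have [] := card_le_total A B. Qed.

Lemma card_leX T U T' U' (A : set T) (B : set U) (A' : set T') (B' : set U') :
  A #<= A' -> B #<= B' -> A `*` B #<= A' `*` B'.
Proof.
move=> /card_le_injP[f fi fA] /card_le_injP[g gi gB]; apply/card_le_injP.
pose h (x : A `*` B) :=
  (f (SigSub (mem_set (set_valP x).1)), g (SigSub (mem_set (set_valP x).2))).
exists h => [x y [/fi /(congr1 val) /= e1 /gi /(congr1 val) /= e2]|x]; last by split; [exact: fA|exact: gB].
by apply: val_inj; apply: injective_projections; [exact: e1|exact: e2].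
Qed.

(** * Squares of infinite sets *)

Section square.
Context (T : Type).

(** Graphs of injections of a square [S * S] into [S], where [S] is recovered as the set of [x] with
    [(x, x)] in the domain. Triples make inclusion of graphs the order for Zorn's lemma. *)
Let closed_graph (G : set (T * T * T)) := [/\
  forall p z z', G (p, z) -> G (p, z') -> z = z',
  forall p p' z, G (p, z) -> G (p', z) -> p = p',
  forall x y u v, G (x, x, u) -> G (y, y, v) -> exists z, G (x, y, z) &
  forall x y z, G (x, y, z) -> [/\ exists u, G (x, x, u), exists u, G (y, y, u)
    & exists u, G (z, z, u)]].

(** Take a maximal injection of some [S * S] into [S] that extends a pairing of the integers. If the
    complement of [S] embeds in [S], then [T] is no larger than [S]. Otherwise a second copy of [S]
    fits outside [S] and gives room to extend the injection. *)
Lemma card_square_setT : infinite_set [set: T] -> [set: T * T] #<= [set: T].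
Proof.
move=> /infiniteP /card_leTP[i ii].
pose G0 := [set (i n.1, i n.2, i (pickle n)) | n in [set: nat * nat]].
have G0c : closed_graph G0.
  split.
  - by move=> p z z' [n _ [<- <-]] [m _ [/ii e1 /ii e2 <-]]; move: n m e1 e2 => [? ?] [? ?] /= -> ->.
  - move=> p p' z [n _ [<- <-]] [m _ [<-]] /ii /(congr1 (@unpickle (nat * nat)%type)).
    by rewrite !pickleK => -[->].
  - move=> x y u v [n _ [<- _ _]] [m _ [<- _ _]]; exists (i (pickle (n.1, m.1))).
    by exists (n.1, m.1).
  - move=> x y z [n _ [<- <- <-]]; split; eexists.
    + by exists (n.1, n.1).
    + by exists (n.2, n.2).
    + by exists (pickle n, pickle n).
(* Zorn's lemma also asks for the union of the empty chain, which is empty; adjoining [G0] inside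
   [Q] settles that case. *)
pose Q G := closed_graph (G0 `|` G).
have [C CQ Ctot|G1 [G1Q G1max]] := @Zorn_bigcup _ Q.
  have [[F0 CF0]|C0] := pselect (C !=set0); last first.
    rewrite /Q (_ : \bigcup_(X in C) X = set0) ?setU0//.
    by rewrite -subset0 => x [F CF]; case: C0; exists F.
  have pair a b : (G0 `|` \bigcup_(X in C) X) a -> (G0 `|` \bigcup_(X in C) X) b ->
      exists F, [/\ C F, (G0 `|` F) a & (G0 `|` F) b].
    case=> [Ga|[F CF Fa]] [Gb|[F' CF' Fb]].
    - by exists F0; split => //; left.
    - by exists F'; split => //; [left|right].
    - by exists F; split => //; [right|left].
    - have [FF|FF] := Ctot _ _ CF CF'.
        by exists F'; split => //; right => //; exact: FF.
      by exists F; split => //; right => //; exact: FF.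
  have sub F a : C F -> (G0 `|` F) a -> (G0 `|` \bigcup_(X in C) X) a.
    by move=> CF [Ga|Fa]; [left|right; exists F].
  split.
  - by move=> p z z' /pair h /h{h} [F [CF Fa Fb]]; have [H _ _ _] := CQ _ CF; exact: H Fa Fb.
  - by move=> p p' z /pair h /h{h} [F [CF Fa Fb]]; have [_ H _ _] := CQ _ CF; exact: H Fa Fb.
  - move=> x y u v /pair h /h{h} [F [CF Fa Fb]]; have [_ _ H _] := CQ _ CF.
    by have [z ?] := H _ _ _ _ Fa Fb; exists z; exact: (sub F).
  - move=> x y z /[dup] /pair h /h{h} [F [CF Fa _]]; have [_ _ _ H] := CQ _ CF.
    have [[u1 ?] [u2 ?] [u3 ?]] := H _ _ _ Fa.
    by split; [exists u1|exists u2|exists u3]; exact: (sub F).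
pose G := G0 `|` G1; have [Gf Gi GS Gr] : closed_graph G by [].
have Gmax H : closed_graph H -> G `<=` H -> H = G.
  move=> Hc GH; apply: contrapT => HG; apply: (G1max H).
    split; first by move=> x G1x; apply: GH; right.
    move=> HG1; apply: HG; apply/seteqP; split => // x Hx.
    by right; apply: HG1.
  by rewrite /Q setUidr// => x G0x; apply: GH; left.
pose S := [set x | exists u, G (x, x, u)].
have Sprod : S `*` S #<= S.
  have ex (p : T * T) : exists z, (S `*` S) p -> G (p, z).
    have [|n] := pselect ((S `*` S) p); last by exists p.1.
    by case: p => x y [[u xu] [v yv]]; have [z] := GS _ _ _ _ xu yv; exists z.
  have [f fP] := choice ex.
  apply: (@card_le_fun _ _ _ _ f) => [p q Sp Sq fpq|[x y] Sp].
    by apply: (Gi _ _ (f p)); [exact: fP|rewrite fpq; exact: fP].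
  by have [_ _ ] := Gr _ _ _ (fP _ Sp).
have Snat n : S (i n) by exists (i (pickle (n, n))); left; exists (n, n).
have boolS : [set: bool] #<= S.
  by apply: (@card_le_fun _ _ _ _ (fun b : bool => i b)) => [[] [] // _ _ /ii|b _].
have bS : [set: bool] `*` S #<= S.
  by apply: card_le_trans Sprod; apply: card_leX => //; exact: card_lexx.
have [leS|leS] := card_le_total (~` S) S.
  have TS : [set: T] #<= S.
    apply: card_le_trans bS; move/card_le_injP : leS => [f fi fS].
    pose h x : bool * T := if pselect (S x) is right nSx then (true, f (SigSub (mem_set (nSx : (~` S) x))))
      else (false, x).
    apply: (@card_le_fun _ _ _ _ h) => [x y _ _|x _]; rewrite /h.
      case: pselect => [Sx|nSx]; case: pselect => [Sy|nSy] //= []//.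
      by move=> /fi /(congr1 val).
    by case: pselect => Sx; split => //=; exact: fS.
  rewrite -setXTT; apply: card_le_trans (subset_card_le (subsetT S)).
  by apply: card_le_trans Sprod; exact: card_leX.
exfalso.
have [g gi gS] : exists2 g : T -> T, (forall x y, S x -> S y -> g x = g y -> x = y) &
    forall x, S x -> ~ S (g x).
  move/card_le_injP : leS => [g gi gS].
  exists (fun x => if pselect (S x) is left Sx then g (SigSub (mem_set Sx)) else x).
    move=> x y Sx Sy; case: pselect => // Sx'; case: pselect => // Sy'.
    by move=> /gi /(congr1 val).
  by move=> x Sx; case: pselect => // Sx'; exact: gS.
pose S' := S `|` g @` S.
have S'S : S' #<= S.
  apply: card_le_trans bS.
  have ex x : exists y, S' x -> S y /\ (x = y \/ ~ S x /\ x = g y).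
    have [Sx|nSx] := pselect (S x); first by exists x => _; split => //; left.
    have [[y Sy yx]|ny] := pselect ((g @` S) x).
      by exists y => _; split => //; right.
    by exists x; case.
  have [f fP] := choice ex.
  apply: (@card_le_fun _ _ _ _ (fun x => (`[< S x >], f x))) => [x y S'x S'y []|x S'x]; last first.
    by split => //; exact: (fP _ S'x).1.
  move=> Sxy fxy.
  have [Sfx [xf|[nSx xf]]] := fP _ S'x; have [Sfy [yf|[nSy yf]]] := fP _ S'y.
  - by rewrite xf yf fxy.
  - by exfalso; apply: nSy; apply/asboolP; rewrite -Sxy; apply/asboolP; rewrite xf.
  - by exfalso; apply: nSx; apply/asboolP; rewrite Sxy; apply/asboolP; rewrite yf.
  - by rewrite xf yf fxy.
have S'2 : S' `*` S' #<= S by apply: card_le_trans Sprod; exact: card_leX.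
have [h hi hS] : exists2 h : T * T -> T,
    (forall p q, (S' `*` S') p -> (S' `*` S') q -> h p = h q -> p = q) &
    (forall p, (S' `*` S') p -> S (h p)).
  move/card_le_injP : S'2 => [h hi hS].
  exists (fun p => if pselect ((S' `*` S') p) is left H then h (SigSub (mem_set H)) else p.1).
    move=> p q Hp Hq; case: pselect => // Hp'; case: pselect => // Hq'.
    by move=> /hi /(congr1 val).
  by move=> p Hp; case: pselect.
have GSS p z : G (p, z) -> (S `*` S) p /\ S z.
  by case: p => x y /Gr[].
(* The pairs outside [S * S] receive values in the copy of [S] under [g], which misses [S], so the
   extended graph stays injective. *)
pose D := [set p | (S' `*` S') p /\ ~ (S `*` S) p].
pose H := G `|` [set (p, g (h p)) | p in D].
have Hdiag x : S' x <-> exists u, H (x, x, u).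
  split=> [S'x|[u [/GSS[[? _] _]|[p [[S'p _] _] [px _]]]]].
  - have [Sx|nSx] := pselect (S x).
      by have [u] := Sx; exists u; left.
    by exists (g (h (x, x))); right; exists (x, x) => //; split => // -[].
  - by left.
  - by move: S'p; rewrite px.
have Hc : closed_graph H.
  split.
  - move=> p z z' [Gz|[q Dq [qp <-]]] [Gz'|[q' Dq' [q'p <-]]].
    + exact: Gf Gz Gz'.
    + by exfalso; apply: Dq'.2; rewrite q'p; exact: (GSS _ _ Gz).1.
    + by exfalso; apply: Dq.2; rewrite qp; exact: (GSS _ _ Gz').1.
    + by rewrite qp q'p.
  - move=> p p' z [Gz|[q Dq [qp qz]]] [Gz'|[q' Dq' [q'p q'z]]].
    + exact: Gi Gz Gz'.
    + exfalso; apply: (gS (h q')); first by apply: hS; exact: Dq'.1.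
      by rewrite q'z; exact: (GSS _ _ Gz).2.
    + exfalso; apply: (gS (h q)); first by apply: hS; exact: Dq.1.
      by rewrite qz; exact: (GSS _ _ Gz').2.
    + rewrite -qp -q'p; apply: hi; [exact: Dq.1|exact: Dq'.1|].
      apply: gi; [by apply: hS; exact: Dq.1|by apply: hS; exact: Dq'.1|].
      by rewrite qz q'z.
  - move=> x y u v xu yv.
    have S'x : S' x by apply/Hdiag; exists u.
    have S'y : S' y by apply/Hdiag; exists v.
    have [[[a xa] [b yb]]|nS] := pselect ((S `*` S) (x, y)).
      by have [z] := GS _ _ _ _ xa yb; exists z; left.
    by exists (g (h (x, y))); right; exists (x, y).
  - move=> x y z Hxyz; suff : S' x /\ S' y /\ S' z.
      by move=> [/Hdiag ? [/Hdiag ? /Hdiag ?]].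
    case: Hxyz => [/GSS[[Sx Sy] Sz]|[p Dp [px <-]]]; first by split; [left|split; left].
    have := Dp.1; rewrite px => -[S'x S'y]; do 2 split => //.
    by right; exists (h p); [exact/hS/Dp.1|rewrite px].
have HG : H = G by apply: Gmax => // x; left.
have S'0 : S' (g (i 0%N)) by right; exists (i 0%N).
have := (Hdiag _).1 S'0; rewrite HG => -[u /GSS[[Sg _] _]].
exact: gS Sg.
Qed.

End square.

Lemma card_prod_le T U V (A : set T) (B : set U) (C : set V) : infinite_set C ->
  A #<= C -> B #<= C -> A `*` B #<= C.
Proof.
move=> iC leAC leBC; apply: (card_le_trans (card_leX leAC leBC)).
have eCC := card_set_type C.
rewrite -(card_le_eqr eCC); apply: (@card_le_trans _ _ _ [set: C * C]).
  by rewrite -setXTT; apply: card_leX; rewrite (card_le_eqr eCC).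
apply: card_square_setT => fC; apply: iC; apply: card_le_finite fC.
by rewrite (card_le_eqr eCC).
Qed.

Lemma card_lt_prod T U V (A : set T) (B : set U) (C : set V) : infinite_set C ->
  C #<= A `*` B -> C #<= A \/ C #<= B.
Proof.
move=> iC CAB; have [?|leAC] := pselect (C #<= A); first by left.
have [?|leBC] := pselect (C #<= B); first by right.
exfalso; have [AB|BA] := card_le_total A B.
  apply: leBC; apply: (card_le_trans CAB); have [fB|iB] := pselect (finite_set B).
    exfalso; apply: iC; apply: (card_le_finite CAB); apply: finite_setX => //.
    exact: card_le_finite AB fB.
  exact: card_prod_le.
apply: leAC; apply: (card_le_trans CAB); have [fA|iA] := pselect (finite_set A).
  exfalso; apply: iC; apply: (card_le_finite CAB); apply: finite_setX => //.
  exact: card_le_finite BA fA.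
exact: card_prod_le.
Qed.

(** A word is folded along an injection of [option T * C] into [C]; the tag [None] marks the end of
    the word and makes decoding unambiguous. *)
Lemma card_seq_le T V (C : set V) : infinite_set C ->
  [set: T] #<= C -> [set: seq T] #<= C.
Proof.
move=> iC TC; have eCC : [set: nat] #<= C by exact/infiniteP.
have [f fi] : exists f : option T * C -> C, injective f.
  apply/card_leTP; rewrite (card_le_eqr (card_set_type C)) -setXTT.
  apply: card_prod_le => //; last by rewrite (card_le_eql (card_set_type C)).
  apply: (@card_le_trans _ _ _ ([set: bool] `*` C)).
    have /infinite_setN0[c0 Cc0] := iC; move/card_le_injP : TC => [g gi gC].
    pose h (o : option T) : bool * V :=
      if o is Some t then (true, g (SigSub (mem_set (I : setT t)))) else (false, c0).
    apply: (@card_le_fun _ _ _ _ h) => [[x|] [y|] _ _ //= [] /gi/(congr1 val)/= -> //|[x|] _] //=.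
  apply: card_prod_le => //; apply: (card_le_trans _ eCC).
  by apply: (@card_le_funT _ _ (fun b : bool => b : nat)) => -[] [].
have /infinite_setN0[c0 Cc0] := iC.
pose d (s : seq T) : C := foldr (fun t c => f (Some t, c)) (f (None, SigSub (mem_set Cc0))) s.
rewrite -(card_le_eqr (card_set_type C)); apply: (@card_le_funT _ _ d).
by elim=> [|x s ih] [|y t] //= /fi []// -> /ih ->.
Qed.

Lemma card_le_choice T U (A : set T) (B : set U) (P : T -> U -> Prop) :
  (forall x, A x -> exists2 y, B y & P x y) ->
  (forall x x' y, A x -> A x' -> P x y -> P x' y -> x = x') -> A #<= B.
Proof.
move=> ex Pi; have /choice[f fP] (x : A) : exists y, B y /\ P (val x) y.
  by have [y By Py] := ex _ (set_valP x); exists y.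
apply/card_le_injP; exists f => [x x' xx'|x]; last exact: (fP x).1.
apply: val_inj; apply: (Pi _ _ (f x) (set_valP x) (set_valP x') (fP x).2).
by rewrite xx'; exact: (fP x').2.
Qed.

End cardinal_comparison.

(** * Initial well-orders, cofinality and fibres of maps *)

Section well_orders.
Local Open Scope card_scope.

Section well_order_theory.
Context (K : Type) (r : rel K) (wr : wochoice.well_order r).

Lemma wo_least (A : set K) : A !=set0 -> exists2 z, A z & forall y, A y -> r z y.
Proof.
move=> [a Aa]; have [|z [[/asboolP Az zA] _]] := wr (A := fun y => `[< A y >]).
  by exists a; exact/asboolP.
by exists z => // y Ay; apply: zA; exact/asboolP.
Qed.

Lemma wo_refl x : r x x.
Proof. by have [|z -> /(_ _ erefl)] := @wo_least [set x]; first by exists x. Qed.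

Lemma wo_total x y : r x y \/ r y x.
Proof.
have [|z [->|->] zxy] := @wo_least [set x; y]; first by exists x; left.
  by left; apply: zxy; right.
by right; apply: zxy; left.
Qed.

Lemma wo_anti x y : r x y -> r y x -> x = y.
Proof.
move=> xy yx; have [|z [_ zu]] := wr (A := fun z => `[< z = x \/ z = y >]).
  by exists x; apply/asboolP; left.
have <- : z = x.
  apply: zu; split; first by apply/asboolP; left.
  by move=> _ /asboolP[|] -> //; exact: wo_refl.
apply: zu; split; first by apply/asboolP; right.
by move=> _ /asboolP[|] -> //; exact: wo_refl.
Qed.

Lemma wo_trans x y z : r x y -> r y z -> r x z.
Proof.
move=> xy yz; have [|t txyz tle] := @wo_least [set t | [\/ t = x, t = y | t = z]].
  by exists x; constructor 1.
case: txyz => te; rewrite te in tle.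
- by apply: tle; constructor 3.
- by rewrite (wo_anti xy (tle _ (Or31 _ _ erefl))).
- by rewrite (wo_anti yz (tle _ (Or32 _ _ erefl))) in xy.
Qed.

Lemma wo_wf : well_founded (fun y x => r y x /\ y <> x).
Proof.
move=> x; apply: contrapT => nx.
have [|z nz zmin] := @wo_least [set x | ~ Acc (fun y x => r y x /\ y <> x) x].
  by exists x.
apply: nz; constructor => y [yz nyz]; apply: contrapT => /zmin zy.
exact: nyz (wo_anti yz zy).
Qed.

End well_order_theory.

(** If some proper segment of a well-order is as large as [K], take the shortest such segment and
    pull the order back along an injection of [K] into it. Segments of the new order then inject
    into strictly shorter segments, which are too small. *)
Lemma initial_well_order_exists (K : Type) : exists r : rel K, initial_well_order r.
Proof.
elim/Pchoice: K => K; have [r wr] := wochoice.well_ordering_principle K.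
pose seg x := [set y | r y x /\ y <> x].
have [nx|ex] := pselect (forall x, ~ ([set: K] #<= seg x)); first by exists r.
have [|x xK xmin] := @wo_least _ r wr [set x | [set: K] #<= seg x].
  by apply: contrapT => n; apply: ex => x Kx; apply: n; exists x.
have [f [fi fx]] : exists f : K -> K, injective f /\ forall y, seg x (f y).
  move/card_le_injP : xK => [f fi fx]; exists (fun y => f (SigSub (mem_set (I : setT y)))).
  by split=> [y z /fi /(congr1 val)//|y]; exact: fx.
exists (fun a b => r (f a) (f b)); split.
  apply: (@wochoice.antisymmetric_well_order _ (fun a b => r (f a) (f b))).
    by move=> a b /andP[ab ba]; apply: fi; exact: (wo_anti wr).
  move=> A [a Aa]; have [|_ [z Az <-] zmin] := @wo_least _ r wr (f @` [set` A]).
    by exists (f a), a.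
  by exists z; split => // y Ay; apply: zmin; exists y.
move=> a Ka; have [fax nfax] := fx a; apply: nfax.
apply: (wo_anti wr) => //; apply: xmin; apply: (card_le_trans Ka).
by apply: (@card_le_fun _ _ _ _ f) => [b c _ _ /fi//|b [ba nba]]; split => // /fi.
Qed.

(* If no proper segment is large enough for A, then choosing new values in A by
   transfinite recursion injects K into A. *)
Lemma card_lt_segment (K T : Type) (r : rel K) (A : set T) : initial_well_order r ->
  ~ ([set: K] #<= A) -> exists x, A #<= [set y | r y x /\ y <> x].
Proof.
elim/Pchoice: T A => T A [wr _] KA; apply: contrapT => nx; apply: KA.
have [k0|K0] := pselect (exists k : K, True); last first.
  rewrite (_ : [set: K] = set0); first exact: card_ge0.
  by rewrite -subset0 => k _; apply: K0; exists k.
have [a0 Aa0] : A !=set0.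
  apply/set0P/eqP => A0; apply: nx; have [k _] := k0; exists k.
  by rewrite A0; exact: card_ge0.
pose F x (rec : forall y, r y x /\ y <> x -> T) : T :=
  xget a0 [set a | A a /\ forall y h, rec y h <> a].
pose g := Fix (wo_wf wr) (fun=> T) F.
have gE x : g x = xget a0 [set a | A a /\ forall y, r y x /\ y <> x -> g y <> a].
  rewrite /g Fix_eq// => z u v uv; rewrite /F; congr xget; apply/seteqP.
  by split=> a [Aa ua]; split => // y h; rewrite ?uv// -uv.
have gP x : A (g x) /\ forall y, r y x /\ y <> x -> g y <> g x.
  rewrite gE; case: xgetP => // nA; exfalso; apply: nx; exists x.
  apply: (card_le_trans (B := g @` [set y | r y x /\ y <> x])); last exact: card_image_le.
  apply: subset_card_le => a Aa; apply: contrapT => na; apply: (nA a); split => // y h ya.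
  by apply: na; exists y.
apply: (@card_le_fun _ _ _ _ g) => [x y _ _ gxy|x _]; last exact: (gP x).1.
apply: contrapT => xy; have [rxy|ryx] := wo_total wr x y.
  by apply: (gP y).2 gxy.
by apply: (gP x).2 (esym gxy); split => // /esym.
Qed.

(** If every fibre were smaller than [K], each would inject into a proper segment. The countably
    many end points lie strictly below some [y], so all fibres fit into the segment [S] below [y]
    and [K] embeds in the product of [nat] and [S]. For infinite [S] this contradicts initiality;
    for finite [S] it makes [K] countable. *)
Lemma uncountable_cofinality_pigeonhole (K : Type) (f : K -> nat) :
  uncountable_cofinality K -> exists n, [set: K] #<= f @^-1` [set n].
Proof.
move=> [r rK cofK]; have [wr segK] := rK; apply: contrapT => nn.
have /choice[x xP] n : exists x, f @^-1` [set n] #<= [set y | r y x /\ y <> x].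
  by apply: card_lt_segment => // Kn; apply: nn; exists n.
have [y yx] : exists y, forall n, ~ r y (x n).
  apply: contrapT => ny; apply: (cofK (range x)).
    by rewrite /countable; exact: card_image_le.
  move=> y; apply: contrapT => nr; apply: ny; exists y => n ryx; apply: nr.
  by exists (x n) => //; exists n.
pose S := [set z | r z y /\ z <> y].
have fS n : f @^-1` [set n] #<= S.
  apply: card_le_trans (xP n) _; apply: subset_card_le => z [zx nzx].
  have xy : r (x n) y by have [//|/yx] := wo_total wr (x n) y.
  split; first exact: wo_trans xy.
  by move=> zy; apply: (yx n); rewrite -zy.
have KS : [set: K] #<= [set: nat] `*` S.
  have /choice[h hP] n : exists h : K -> K,
      (forall u v, f u = n -> f v = n -> h u = h v -> u = v) /\ forall u, f u = n -> S (h u).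
    move/card_le_injP : (fS n) => [h hi hS].
    exists (fun u => if pselect (f u = n) is left e then h (SigSub (mem_set (e : (f @^-1` [set n]) u))) else u).
    split=> [u v fu fv|u fu]; case: pselect => // ?.
    by case: pselect => // ? /hi /(congr1 val).
  apply: (@card_le_fun _ _ _ _ (fun u => (f u, h (f u) u))) => [u v _ _ [fuv]|u _].
    by rewrite -fuv; exact: (hP (f u)).1.
  by split => //; exact: (hP (f u)).2.
apply: (segK y); have [fS0|iS] := pselect (finite_set S); last first.
  by apply: (card_le_trans KS); apply: card_prod_le => //; exact/infiniteP.
exfalso; apply: (cofK setT); last by move=> z; exists z => //; exact: wo_refl.
by apply: (sub_countable KS); apply: countableX => //; exact: finite_set_countable.
Qed.

Lemma card_le_self_fun T (A B : set T) : A #<= B -> exists f : T -> T,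
  (forall x y, A x -> A y -> f x = f y -> x = y) /\ forall x, A x -> B (f x).
Proof.
move=> /card_le_injP[f fi fB].
exists (fun x => if pselect (A x) is left Ax then f (SigSub (mem_set Ax)) else x).
split=> [x y Ax Ay|x Ax]; case: pselect => // ?.
by case: pselect => // ? /fi /(congr1 val).
Qed.

(* Take W of least cardinality among the sets with large preimage. If |W| < |Y|,
   enumerate W in its initial order and keep only the points whose fibre is larger
   than all earlier ones: these are as many, and any |W| of them have fibres that
   are unbounded among all the fibres. *)
Lemma regular_image T U (Y : set T) (f : T -> U) : infinite_set Y ->
  exists2 W : set U, W `<=` f @` Y &
    forall V, V `<=` W -> V #= W -> Y #<= Y `&` f @^-1` V.
Proof.
move=> iY; pose P := [set W | W `<=` f @` Y /\ Y #<= Y `&` f @^-1` W].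
have [|W [WY YW] Wmin] := @card_le_wf U P.
  exists (f @` Y); split => //; apply: subset_card_le => y Yy; split => //.
  by exists y.
have fibV V : V `<=` f @` Y -> V #<= Y `&` f @^-1` V.
  move=> VY; apply: (@card_le_choice _ _ _ _ (fun v y => f y = v)) => [v Vv|v v' y _ _ <-//].
  by have [y Yy yv] := VY _ Vv; exists y => //; split; rewrite //= yv.
have [YleW|YW'] := pselect (Y #<= W).
  exists W => // V VW VeqW; apply: (card_le_trans YleW).
  by rewrite -(card_le_eql VeqW); apply: fibV; exact: subset_trans WY.
pose fib (u : U) := Y `&` f @^-1` [set u].
(* If fibres over [V] dominate those over [W], then [Y] embeds in the product of [W] with the
   preimage of [V]. As [W] is smaller than [Y], the preimage must be as large as [Y]. *)
have dom V : (forall t, W t -> exists2 v, V v & fib t #<= fib v) -> Y #<= Y `&` f @^-1` V.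
  move=> WV; have /choice[h hP] (t : U) : exists h : T -> T, W t ->
      (forall x y, fib t x -> fib t y -> h x = h y -> x = y) /\
      forall x, fib t x -> (Y `&` f @^-1` V) (h x).
    have [Wt|] := pselect (W t); last by exists id.
    have [v Vv /card_le_self_fun[h [hi hv]]] := WV _ Wt.
    by exists h => _; split => // x /hv[Yhx fhx]; split => //=; rewrite fhx.
  have [|//|//] := @card_lt_prod _ _ _ W (Y `&` f @^-1` V) Y iY.
  apply: (card_le_trans YW).
  apply: (@card_le_fun _ _ _ _ (fun y => (f y, h (f y) y))) => [x y [Yx Wx] [Yy Wy] [fxy]|x [Yx Wx]].
    by rewrite -fxy; apply: (hP _ Wx).1; split.
  by split => //; apply: (hP _ Wx).2.
have [r [wr rinit]] := initial_well_order_exists W.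
pose rec (t : W) := forall s, r s t -> s <> t -> ~ (fib (val t) #<= fib (val s)).
pose W1 := val @` rec.
have W1W : W1 `<=` W by move=> _ [t _ <-]; exact: set_valP.
have domW1 t : W t -> exists2 v, W1 v & fib t #<= fib v.
  move=> Wt; pose t' : W := SigSub (mem_set Wt).
  have [|s ts smin] := @wo_least _ r wr [set s | fib (val t') #<= fib (val s)].
    by exists t' => /=; exact: card_lexx.
  exists (val s) => //; exists s => // u us nus su.
  by apply: nus; apply: (wo_anti wr) => //; apply: smin; exact: card_le_trans su.
have PW1 : P W1 by split; [exact: subset_trans WY|exact: dom].
exists W1; first exact: PW1.1.
move=> V VW1 VeqW1; apply: dom => t /domW1[_ [s recs <-] ts].
suff [u [recu Vu su]] : exists u : W, [/\ rec u, V (val u) & r s u].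
  exists (val u) => //; apply: (card_le_trans ts).
  have [->|nsu] := pselect (s = u); first exact: card_lexx.
  by apply: card_leNgt; exact: recu.
(* Otherwise all of [V] precedes [s]; by minimality of [W], a proper segment of the initial order
   would then be as large as [W]. *)
apply: contrapT => nu; apply: (rinit s).
rewrite (card_le_eql (card_set_type W)); apply: (card_le_trans (Wmin _ PW1)).
rewrite -(card_le_eql VeqW1).
apply: (@card_le_choice _ _ _ _ (fun v (u : W) => val u = v)) => [v Vv|v v' y _ _ <-//].
have [u recu uv] := VW1 _ Vv; exists u => //.
have nsu : ~ r s u by move=> su; apply: nu; exists u; split => //; rewrite uv.
split; first by have [|] := wo_total wr u s.
by move=> us; apply: nsu; rewrite us; exact: wo_refl.
Qed.

End well_orders.

(** * The cardinality of the continuum *)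

Section continuum.
Local Open Scope card_scope.

(** König's argument: split [x] into rows [pr n x]. If every fibre were smaller than the continuum,
    the [n]-th rows of the [n]-th fibre would miss some [z n], and the point with rows [z n] would
    lie in no fibre. *)
Lemma cantor_pigeonhole (f : (nat -> bool) -> nat) :
  exists n, [set: nat -> bool] #<= f @^-1` [set n].
Proof.
apply: contrapT => nn; pose pr (n : nat) (x : nat -> bool) (k : nat) := x (pickle (n, k)).
have /choice[z zP] n : exists z, ~ (pr n @` (f @^-1` [set n])) z.
  apply: contrapT => nz; apply: nn; exists n.
  apply: card_le_trans (card_image_le (pr n) _); apply: subset_card_le => z _.
  by apply: contrapT => ?; apply: nz; exists z.
pose x m := if @unpickle (nat * nat)%type m is Some p then z p.1 p.2 else false.
apply: (zP (f x)); exists x => //; apply/funext => k.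
by rewrite /pr /x pickleK.
Qed.

Lemma cantor_uncountable : ~ ([set: nat -> bool] #<= [set: nat]).
Proof.
move=> /card_leTP[f fi].
pose x n := ~~ `[< exists2 y, f y = n & y n >].
have [[y fyx yx]|nx] := pselect (exists2 y, f y = f x & y (f x)).
  have xx : x (f x) by move: yx; rewrite (fi _ _ fyx).
  by move: (xx); rewrite /x; move/asboolP; apply; exists x.
by apply: (nx); exists x => //; apply/asboolP.
Qed.

Lemma card_pred_countType (I : countType) : [set: I -> bool] #<= [set: nat -> bool].
Proof.
apply: (@card_le_funT _ _ (fun g n => if @unpickle I n is Some i then g i else false)).
by move=> g h gh; apply/funext => i; have := congr1 (@^~ (pickle i)) gh; rewrite pickleK.
Qed.

(** A real is determined by the rationals below it, so a sequence is coded by a set of pairs of an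
    index and a rational. *)
Lemma card_realseq (R : realType) : [set: nat -> R] #<= [set: nat -> bool].
Proof.
apply: card_le_trans (card_pred_countType (nat * rat)%type).
apply: (@card_le_funT _ _ (fun (u : nat -> R) p => ratr p.2 < u p.1)) => u v uv.
suff le (a b : nat -> R) n : (fun p : nat * rat => ratr p.2 < a p.1) =
    (fun p => ratr p.2 < b p.1) -> a n <= b n.
  by apply/funext => n; apply: le_anti; rewrite !le.
move=> ab; rewrite leNgt; apply/negP => /rat_in_itvoo[q]; rewrite in_itv/= => /andP[bq qa].
have := congr1 (@^~ (n, q)) ab; rewrite /= qa => /esym.
by rewrite ltNge (ltW bq).
Qed.

End continuum.

(** * The Cantor set and the dual ball *)

Section prefix_lookup.

(* Countably many L suffice to realise all finite partial functions on the
   Cantor set. *)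
Definition prefix_lookup (L : seq (seq bool * option bool)) (x : nat -> bool) :=
  head None [seq p.2 | p <- L & p.1 == mkseq x (size p.1)].

Lemma separating_length (k : choiceType) (i : k -> nat -> bool) (s : seq (k * k)) :
  injective i -> exists n, forall p, p \in s ->
    mkseq (i p.1) n = mkseq (i p.2) n -> p.1 = p.2.
Proof.
move=> ii; elim: s => [|[a b] s [n nP]]; first by exists 0%N.
have [m mP] : exists m, i a =1 i b \/ i a m <> i b m.
  have [ab|nab] := pselect (i a =1 i b); first by exists 0%N; left.
  apply: contrapT => nm; apply: nab => m; apply: contrapT => im.
  by apply: nm; exists m; right.
exists (maxn n m.+1) => p; rewrite inE => /predU1P[->|ps] /= epq.
  case: mP => [/funext/ii//|nm]; exfalso; apply: nm.
  have lt : (m < maxn n m.+1)%N by rewrite leq_max ltnSn orbT.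
  by rewrite -(nth_mkseq false (i a) lt) epq nth_mkseq.
apply: nP => //; apply: (@eq_from_nth _ false); rewrite ?size_mkseq// => l ln.
have lt : (l < maxn n m.+1)%N by rewrite leq_max ln.
by rewrite !nth_mkseq// -(nth_mkseq false (i p.1) lt) epq nth_mkseq.
Qed.

Lemma prefix_lookup_surj (k : choiceType) (i : k -> nat -> bool) (s : seq k)
    (f : k -> option bool) :
  injective i -> exists L, forall x, x \in s -> prefix_lookup L (i x) = f x.
Proof.
move=> ii; have [n nP] := separating_length [seq (a, b) | a <- s, b <- s] ii.
(* Prefixes of length [n] separate the points of [s], so the first match returned by [head] belongs
   to the point that is looked up. *)
exists [seq (mkseq (i a) n, f a) | a <- s] => x xs.
have : forall a, a \in s -> mkseq (i a) n = mkseq (i x) n -> a = x.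
  by move=> a sa; apply: (nP (a, x)); apply/allpairsP; exists (a, x).
elim: s xs {nP} => // a s ih; rewrite inE /prefix_lookup /= size_mkseq => xs sep.
case: eqP => [/sep -> //|nax]; first by rewrite mem_head.
case/predU1P: xs => [xa|xs]; first by rewrite xa in nax.
by apply: ih => // b bs; apply: sep; rewrite inE bs orbT.
Qed.

End prefix_lookup.

Section dual_ball.
Context {R : realType} {X : normedModType R}.
Implicit Types (m : X -> R).

(** Functionals are kept as plain functions, so that the weak* topology is the product topology on
    [X -> R]. *)
Definition dual_ball (C : R) : set (X -> R) := [set m |
  (forall a x y, m (a *: x + y) = a * m x + m y) /\ forall x, `|m x| <= C * `|x|].

Section dual_ball_theory.
Context (C : R) (m : X -> R) (mC : dual_ball C m).

Lemma dual_ball0 : m 0 = 0.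
Proof. by have := mC.1 (-1) 0 0; rewrite scaleN1r oppr0 addr0 mulN1r addNr. Qed.

Lemma dual_ballD x y : m (x + y) = m x + m y.
Proof. by have := mC.1 1 x y; rewrite scale1r mul1r. Qed.

Lemma dual_ballZ a x : m (a *: x) = a * m x.
Proof. by have := mC.1 a x 0; rewrite !addr0 dual_ball0 addr0. Qed.

Lemma dual_ballB x y : m (x - y) = m x - m y.
Proof. by rewrite dual_ballD -scaleN1r dual_ballZ mulN1r. Qed.

Lemma dual_ball_sum n (a : 'I_n -> R) (z : 'I_n -> X) :
  m (\sum_i a i *: z i) = \sum_i a i * m (z i).
Proof.
apply: (big_rec2 (fun x y => m x = y)) => [|i x y _ <-]; first exact: dual_ball0.
by rewrite mC.1.
Qed.

End dual_ball_theory.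

Local Notation XR := (prod_topology (fun _ : X => R)).

Lemma functional_eval_continuous (x : X) : continuous (fun m : XR => m x : R).
Proof. exact: (@proj_continuous X (fun=> R) x). Qed.

Let defect_continuous (a : R) x y :
  continuous (fun m : XR => m (a *: x + y) - (a * m x + m y) : R).
Proof.
move=> m.
apply: (@cvgB _ _ _ (nbhs (m : XR)) _ (fun m : XR => m (a *: x + y)) (fun m : XR => a * m x + m y)).
  exact: functional_eval_continuous.
apply: (@cvgD _ _ _ (nbhs (m : XR)) _ (fun m : XR => a * m x) (fun m : XR => m y)).
  apply: (@cvgMl_tmp _ _ (nbhs (m : XR)) _ (fun m : XR => m x)).
  exact: functional_eval_continuous.
exact: functional_eval_continuous.
Qed.

Let norm_functional_eval_continuous x : continuous (fun m : XR => `|m x|).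
Proof.
move=> m; apply: (@cvg_norm _ _ _ (nbhs (m : XR)) _ (fun m : XR => m x)).
exact: functional_eval_continuous.
Qed.

(** Banach-Alaoglu: linearity and the norm bound are closed conditions inside a product of compact
    intervals. *)
Lemma dual_ball_compact C : compact (dual_ball C : set XR).
Proof.
have K := @tychonoff X (fun=> R) (fun x => [set` `[- (C * `|x|), C * `|x|]])
  (fun x => @segment_compact R _ _).
apply: (@subclosed_compact XR _ _ _ K) => [|m [_ mC] x]; last first.
  by rewrite /= in_itv/= -ler_norml.
have -> : dual_ball C = (\bigcap_(t : R * X * X)
    ((fun m : XR => m (t.1.1 *: t.1.2 + t.2) - (t.1.1 * m t.1.2 + m t.2)) @^-1` [set 0 : R]))
  `&` (\bigcap_(x : X) ((fun m : XR => `|m x|) @^-1` [set r : R | r <= C * `|x|])).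
  apply/seteqP; split=> [m [mL mC]|m [mL mC]].
    split=> [[[a x] y] _ /=|x _ /=]; last exact: mC.
    by rewrite mL subrr.
  split=> [a x y|x]; last exact: (mC x).
  by apply/eqP; rewrite -subr_eq0; apply/eqP; exact: (mL (a, x, y) I).
apply: closedI; apply: closed_bigI => t _.
  apply: (@preimage_closed XR R); last exact: closed_eq.
  by move=> m _; exact: defect_continuous.
apply: (@preimage_closed XR R); last exact: closed_le.
by move=> m _; exact: norm_functional_eval_continuous.
Qed.

End dual_ball.

(** * Minimal closed sets of functionals realising all signs *)

Section independent_functionals.
Context {R : realType} {X : normedModType R} {k : choiceType}.
Context (e : k -> X) (C : R).
Implicit Types (m : X -> R) (F : seq k) (s : k -> bool) (A N : set (X -> R)).

Definition signs_on F s : set (X -> R) :=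
  [set m | forall i, i \in F -> m (e i) = (s i)%:R].

Definition all_signs A := forall F s, exists2 m, A m & signs_on F s m.

Local Notation XR := (prod_topology (fun _ : X => R)).

Let open_near x (c r : R) : open ([set m | `|m x - c| < r] : set XR).
Proof.
apply: (@open_comp XR R (fun m => `|m x - c|) [set t | t < r]) => [m _|]; last exact: open_lt.
apply: (@cvg_norm _ _ _ (nbhs (m : XR)) _ (fun m : XR => m x - c)).
apply: (@cvgB _ _ _ (nbhs (m : XR)) _ (fun m : XR => m x) (fun=> c)); last exact: cvg_cst.
exact: functional_eval_continuous.
Qed.

Let signs_on_closed F s : closed (signs_on F s : set XR).
Proof.
have -> : signs_on F s = \bigcap_(i in [set` F]) ((fun m : XR => m (e i) : R) @^-1` [set (s i)%:R]).
  by apply/seteqP; split => m mF i iF; exact: mF.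
apply: closed_bigI => i _; apply: (@preimage_closed XR R); last exact: closed_eq.
by move=> m _; exact: functional_eval_continuous.
Qed.

(** Zorn's lemma is applied to the open complements. Along a chain, the functionals with a given
    finite sign pattern form nested nonempty compact sets, so one of them survives outside the
    union. *)
Let minimal_all_signs : all_signs (dual_ball C) ->
  exists O : set XR, [/\ open O, all_signs (dual_ball C `\` O) &
    forall U : set XR, open U -> all_signs (dual_ball C `\` (O `|` U)) -> U `<=` O].
Proof.
move=> NS; pose P := [set O : set XR | open O /\ all_signs (dual_ball C `\` O)].
have [D DP Dtot|O [[oO OS] Omax]] := @Zorn_bigcup _ P; last first.
  exists O; split => // U oU US; apply: contrapT => UO.
  apply: (Omax (O `|` U)); first by split; [left|move=> OU; apply: UO => m Um; apply: OU; right].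
  by split => //; exact: openU.
split; first by apply: bigcup_open => U /DP[].
move=> F s; apply: contrapT => nm.
have cNF : @compact XR (dual_ball C `&` signs_on F s).
  have K := @dual_ball_compact R X C.
  apply: (@subclosed_compact XR _ _ _ K) => [|m []//].
  apply: closedI; last exact: signs_on_closed.
  apply: (@compact_closed XR _ _ K); apply: hausdorff_product => _.
  exact: Rhausdorff.
have cover : dual_ball C `&` signs_on F s `<=` \bigcup_(U in D) U.
  move=> m [mC mF]; apply: contrapT => nD; apply: nm; exists m => //.
have [m0 m0C m0F] := NS F s.
have [U0 DU0 _] := cover m0 (conj m0C m0F).
pose G := filter_from D (fun U => (dual_ball C `\` U) `&` signs_on F s).
have FG : ProperFilter G.
  apply: filter_from_proper; last first.
    by move=> U DU; have [m mCU mF] := (DP _ DU).2 F s; exists m.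
  apply: filter_from_filter; first by exists U0.
  move=> U V DU DV; have [UV|VU] := Dtot _ _ DU DV.
    by exists V => // m [[mC mV] mF]; split; split => //; split => // /UV.
  by exists U => // m [[mC mU] mF]; split; split => //; split => // /VU.
have [|m [/cover[U DU Um] clm]] := cNF G FG.
  by exists U0 => // m [[]].
have GU : G ((dual_ball C `\` U) `&` signs_on F s) by exists U.
have [m' [[[_ nU] _] Um']] := clm _ _ GU (open_nbhs_nbhs (conj (DP _ DU).1 Um)).
exact: nU.
Qed.

(* N is a minimal closed set that maps onto the cube of signs. *)
Lemma small_oscillation : all_signs (dual_ball C) ->
  exists N, [/\ N `<=` dual_ball C, all_signs N &
    forall x F s (r : R), 0 < r -> exists F' s', [/\ {subset F <= F'},
      forall i, i \in F -> s' i = s i &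
      forall m m', N m -> N m' -> signs_on F' s' m -> signs_on F' s' m' ->
        `|m x - m' x| <= r]].
Proof.
move=> /minimal_all_signs[ O [oO OS Omax]]; exists (dual_ball C `\` O).
split=> [m [//]|//|x F s r r0].
have [m0 [m0C m0O] m0F] := OS F s.
(* A functional with prescribed signs takes the value 0 or 1 at [e i], so distance less than 1
   already fixes the sign. *)
pose W : set XR := [set m | `|m x - m0 x| < r / 2] `&`
  [set m | forall i, i \in F -> `|m (e i) - (s i)%:R| < 1].
have oW : open W.
  apply: openI; first exact: open_near.
  elim: F {m0F W} => [|i F ih].
    by rewrite [X in open X](_ : _ = setT)//; [exact: openT|apply/seteqP; split].
  rewrite [X in open X](_ : _ = [set m : XR | `|m (e i) - (s i)%:R| < 1] `&`
      [set m | forall i, i \in F -> `|m (e i) - (s i)%:R| < 1]); last first.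
    apply/seteqP; split=> [m mF|m [mi mF] j]; last by rewrite inE => /predU1P[->|/mF].
    by split=> [|j jF]; apply: mF; rewrite inE ?eqxx ?jF ?orbT.
  by apply: openI => //; exact: open_near.
have m0W : W m0.
  split=> [|i iF] /=; first by rewrite subrr normr0 divr_gt0.
  by rewrite m0F// subrr normr0.
(* Since [W] contains the point [m0] outside [O], removing [W] as well must destroy some finite
   pattern [z] on [F1]. Functionals outside [O] with that pattern therefore all lie in [W]. *)
have /existsNP[F1 /existsNP[z nm]] : ~ all_signs (dual_ball C `\` (O `|` W)).
  by move=> /(Omax _ oW) WO; apply: m0O; exact: WO.
have inW m : (dual_ball C `\` O) m -> signs_on (F ++ F1) z m -> W m.
  move=> [mC mO] mz; apply: contrapT => mW; apply: nm; exists m.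
    by split => // -[].
  by move=> i iF1; apply: mz; rewrite mem_cat iF1 orbT.
exists (F ++ F1), z; split=> [i iF|i iF|m m' Nm Nm' mz m'z].
- by rewrite mem_cat iF.
(* Some functional outside [O] has the pattern [z]; it lies in [W], which forces [z] to agree with
   [s] on [F]. *)
- have [m Nm mz] := OS (F ++ F1) z.
  have [_ /(_ i iF)] := inW _ Nm mz; rewrite mz ?mem_cat ?iF//.
  by case: (z i) (s i) => -[]; rewrite /= ?subr0 ?sub0r ?normrN ?normr1 ?ltxx.
- have [/= d _] := inW _ Nm mz; have [/= d' _] := inW _ Nm' m'z.
  rewrite (splitr r) -(subrK (m0 x) (m x)) -addrA (le_trans (ler_normD _ _))//.
  by rewrite lerD ?ltW// distrC.
Qed.

End independent_functionals.

Section span.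
Context {R : realType} {X : normedModType R}.

Lemma linearly_dense_approx (Z : set X) (x : X) (r : R) : linearly_dense Z -> 0 < r ->
  exists2 v, lin_span Z v & `|x - v| < r.
Proof.
move=> dZ r0; have [|v [xv Zv]] := dZ (ball x r) _ (ball_open x r).
  by exists x; exact: ballxx.
by exists v => //; move: xv; rewrite -ball_normE.
Qed.

End span.

Section gap.

(** * Vectors of a spanning set that react to a given sign *)

Context {R : realType} {X : normedModType R} {k : choiceType}.
Context (e : k -> X) (C : R) (C0 : 0 < C) (N : set (X -> R)).
Hypothesis NC : N `<=` dual_ball C.
Hypothesis NS : all_signs e N.
Hypothesis NO : forall x (F : seq k) (s : k -> bool) (r : R), 0 < r ->
  exists F' s', [/\ {subset F <= F'}, forall i, i \in F -> s' i = s i &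
    forall m m', N m -> N m' -> signs_on e F' s' m -> signs_on e F' s' m' ->
      `|m x - m' x| <= r].
Implicit Types (F : seq k) (s : k -> bool).

Definition sign_upd s i b := fun j => if j == i then b else s j.

(** The value of [s'] at [i] is left free because [sign_upd] overwrites it. *)
Let flat i x := forall F s (r : R), 0 < r -> exists F' s', [/\ {subset F <= F'},
  forall j, j \in F -> j != i -> s' j = s j &
  forall m m', N m -> N m' -> signs_on e (i :: F') (sign_upd s' i true) m ->
    signs_on e (i :: F') (sign_upd s' i false) m' -> `|m x - m' x| <= r].

Let signs_on_weaken i F F' s s' b m : {subset F <= F'} ->
  (forall j, j \in F -> j != i -> s' j = s j) ->
  signs_on e (i :: F') (sign_upd s' i b) m -> signs_on e (i :: F) (sign_upd s i b) m.
Proof.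
move=> FF ss mF j; rewrite inE => jF; rewrite mF; last first.
  by rewrite inE; case/orP: jF => [->//|/FF ->]; rewrite orbT.
rewrite /sign_upd; case: eqVneq => // ji; rewrite ss//.
by move: jF; rewrite (negbTE ji).
Qed.

(** For a sum, the pattern for the second vector is built on top of the pattern for the first, which
    keeps both estimates. *)
Let flat_span i (Y : set X) : Y `<=` flat i -> lin_span Y `<=` flat i.
Proof.
move=> Yf _ [n [a [z [zY ->]]]]; apply: (big_ind (flat i)) => [F s r r0|x y fx fy F s r r0|j _ F s r r0].
- exists F, s; split=> // m m' /NC mC /NC m'C _ _.
  by rewrite (dual_ball0 mC) (dual_ball0 m'C) subrr normr0 ltW.
- have r20 : 0 < r / 2 by rewrite divr_gt0.
  have [F1 [s1 [FF1 ss1 F1P]]] := fx F s _ r20.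
  have [F2 [s2 [FF2 ss2 F2P]]] := fy F1 s1 _ r20.
  exists F2, s2; split=> [j /FF1/FF2//|j jF ji|m m' Nm Nm' mF m'F].
    by rewrite ss2 ?ss1 ?FF1.
  rewrite (dual_ballD (NC Nm)) (dual_ballD (NC Nm')) opprD addrACA (splitr r).
  rewrite (le_trans (ler_normD _ _))// lerD//; last exact: F2P.
  by apply: F1P => //; exact: signs_on_weaken FF2 ss2 _.
- have a0 : 0 < `|a j| + 1 by rewrite ltr_wpDl.
  have [F1 [s1 [FF1 ss1 F1P]]] := Yf _ (zY j) F s _ (divr_gt0 r0 a0).
  exists F1, s1; split=> // m m' Nm Nm' mF m'F.
  rewrite (dual_ballZ (NC Nm)) (dual_ballZ (NC Nm')) -mulrBr normrM.
  have := F1P _ _ Nm Nm' mF m'F; rewrite ler_pdivlMr// mulrC.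
  by apply: le_trans; rewrite ler_wpM2r// lerDl.
Qed.

(* The vectors that can be made insensitive to the i-th sign form a closed
   subspace, which misses e i. *)
Lemma gap_exists (Y : set X) (i : k) : linearly_dense Y ->
  exists y F s (p q : rat) b, [/\ Y y, p < q,
    forall m, N m -> signs_on e (i :: F) (sign_upd s i b) m -> ratr q <= m y &
    forall m, N m -> signs_on e (i :: F) (sign_upd s i (~~ b)) m -> m y <= ratr p].
Proof.
move=> dY; have [y Yy nf] : exists2 y, Y y & ~ flat i y.
  apply: contrapT => nY; have Yf : Y `<=` flat i.
    by move=> y Yy; apply: contrapT => nf; apply: nY; exists y.
  (* At this distance a functional of [N] moves by at most 1/4 between [e i] and [v]. With flatness
     of [v] at tolerance 1/4, the values 1 and 0 at [e i] would differ by at most 3/4. *)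
  have r0 : 0 < (4 * C)^-1 by rewrite invr_gt0 mulr_gt0.
  have [v Yv ev] := linearly_dense_approx (e i) dY r0.
  have [|F [s [_ _ FP]]] := flat_span Yf Yv [::] (fun=> true) (r := 4^-1).
    by rewrite invr_gt0.
  have [m Nm mF] := NS (i :: F) (sign_upd s i true).
  have [m' Nm' m'F] := NS (i :: F) (sign_upd s i false).
  have mi : m (e i) = 1 by rewrite mF ?mem_head// /sign_upd eqxx.
  have m'i : m' (e i) = 0 by rewrite m'F ?mem_head// /sign_upd eqxx.
  have small f : N f -> `|f (e i) - f v| <= 4^-1.
    move=> /NC fC; rewrite -(dual_ballB fC) (le_trans (fC.2 _))//.
    rewrite -ler_pdivlMl// (le_trans (ltW ev))// invfM mulrC.
    by [].
  have := FP _ _ Nm Nm' mF m'F; have := small _ Nm; have := small _ Nm'.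
  rewrite mi m'i sub0r normrN !ler_norml => /andP[? ?] /andP[? ?] /andP[? ?].
  by lra.
move: nf => /existsNP[F /existsNP[s /existsNP[r nf]]].
have r0 : 0 < r by apply: contrapT => r0; apply: nf => /r0.
have {}nf := contra_not (fun h => fun=> h) nf.
have r30 : 0 < r / 3 by rewrite divr_gt0.
(* The oscillation of [y] is made small first with the [i]-th sign true, then with it false. Off
   [i], [s2] keeps the first pattern, so both bounds hold over [F2]. *)
have [F1 [s1 [FF1 ss1 F1P]]] := NO y (i :: F) (sign_upd s i true) r30.
have [F2 [s2 [FF2 ss2 F2P]]] := NO y (i :: F1) (sign_upd s1 i false) r30.
have FF2' : {subset F <= F2}.
  by move=> j jF; apply: FF2; rewrite inE FF1 ?orbT// inE jF orbT.
have s21 j : j \in F1 -> j != i -> s2 j = s1 j.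
  by move=> jF ji; rewrite ss2 ?inE ?jF ?orbT// /sign_upd (negbTE ji).
have ext : forall j, j \in F -> j != i -> s2 j = s j.
  move=> j jF ji; rewrite s21 ?ss1 ?FF1 ?inE ?jF ?orbT// /sign_upd (negbTE ji)//.
have iF1 : i \in F1 by apply: FF1; rewrite mem_head.
have iF2 : i \in F2 by apply: FF2; rewrite mem_head.
have s1i : s1 i = true by rewrite ss1 ?mem_head// /sign_upd eqxx.
have s2i : s2 i = false by rewrite ss2 ?mem_head// /sign_upd eqxx.
have onT m : signs_on e (i :: F2) (sign_upd s2 i true) m -> signs_on e F1 s1 m.
  move=> mF j jF1; rewrite mF; last by rewrite inE FF2 ?orbT// inE jF1 orbT.
  by rewrite /sign_upd; case: eqVneq => [->|ji]; rewrite ?s1i// s21.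
have onF m : signs_on e (i :: F2) (sign_upd s2 i false) m -> signs_on e F2 s2 m.
  move=> mF j jF2; rewrite mF; last by rewrite inE jF2 orbT.
  by rewrite /sign_upd; case: eqVneq => [->|//]; rewrite s2i.
have [m [m' [Nm Nm' mF m'F mm']]] : exists m m', [/\ N m, N m',
    signs_on e (i :: F2) (sign_upd s2 i true) m,
    signs_on e (i :: F2) (sign_upd s2 i false) m' & r < `|m y - m' y|].
  apply: contrapT => nm; apply: nf; exists F2, s2; split=> // m m' Nm Nm' mF m'F.
  by rewrite leNgt; apply/negP => rmm'; apply: nm; exists m, m'.
have {}F1P f : N f -> signs_on e (i :: F2) (sign_upd s2 i true) f -> `|f y - m y| <= r / 3.
  by move=> Nf fF; apply: F1P => //; exact: onT.
have {}F2P f : N f -> signs_on e (i :: F2) (sign_upd s2 i false) f -> `|f y - m' y| <= r / 3.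
  by move=> Nf fF; apply: F2P => //; exact: onF.
(* The two values differ by more than [r] and each side varies by at most [r / 3], which leaves an
   interval for the rationals [p < q]. *)
have pick (u v : R) : v + r < u -> exists p q : rat, [/\ p < q, v + r / 3 <= ratr p &
    ratr q <= u - r / 3].
  move=> uv; have : v + r / 3 < (u + v) / 2 by lra.
  move=> /rat_in_itvoo[p]; rewrite in_itv/= => /andP[vp pu].
  have : (u + v) / 2 < u - r / 3 by lra.
  move=> /rat_in_itvoo[q]; rewrite in_itv/= => /andP[uq qu].
  by exists p, q; split; rewrite ?(ltW vp) ?(ltW qu)// -(ltr_rat R) (lt_trans pu).
move: mm'; rewrite lter_normr => /orP[mm'|mm'].
  have [|p [q [pq vp qu]]] := pick (m y) (m' y); first by lra.
  exists y, F2, s2, p, q, true; split=> // f Nf fF.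
    by have := F1P f Nf fF; rewrite ler_norml => /andP[? ?]; lra.
  by have := F2P f Nf fF; rewrite ler_norml => /andP[? ?]; lra.
have [|p [q [pq vp qu]]] := pick (m' y) (m y); first by lra.
exists y, F2, s2, p, q, false; split=> // f Nf fF.
  by have := F2P f Nf fF; rewrite ler_norml => /andP[? ?]; lra.
by have := F1P f Nf fF; rewrite ler_norml => /andP[? ?]; lra.
Qed.

End gap.

(** Two errors of at most [d / 4] and [S <= S'] would give [u - v <= d / 2]. *)
Lemma gap_absurd (R : realType) (d u v S S' : R) : 0 < d -> d <= u - v -> S - S' <= 0 ->
  `|u - S| <= d / 4 -> `|v - S'| <= d / 4 -> False.
Proof. by rewrite !ler_norml => ? ? ? /andP[? ?] /andP[? ?]; lra. Qed.

(** * A large subset that is not linearly dense *)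

Section core.
Local Open Scope card_scope.

Lemma card_le_setD1 T (A : set T) (a : T) : infinite_set A -> A #<= A `\ a.
Proof.
move=> iA; have iD : infinite_set (A `\ a) by exact: infinite_setD.
have [b Db] := infinite_setN0 iD.
apply: (@card_le_trans _ _ _ ([set: bool] `*` (A `\ a))).
  pose f x := if pselect (x = a) then (true, b) else (false, x).
  apply: (@card_le_fun _ _ _ _ f) => [x y _ _|x Ax]; rewrite /f.
    by case: pselect => xa; case: pselect => ya //=; [rewrite xa ya|case..].
  by case: pselect => xa; split.
apply: card_prod_le => //; apply: (@card_le_trans _ _ _ [set: nat]); last exact/infiniteP.
exact: countableP.
Qed.

Context {R : realType} {X : normedModType R} {k : choiceType}.
Context (c : k -> nat -> bool) (ci : injective c).
Hypothesis ki : infinite_set [set: k].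
Hypothesis kp : forall f : k -> nat, exists n, [set: k] #<= f @^-1` [set n].
Context (e : k -> X) (C : R) (C0 : 0 < C).
Hypothesis eC : all_signs e (dual_ball C).

(* The conditions given by gap_exists are of countably many types, since
   k embeds in the Cantor set. Any subfamily of Y coming from conditions of
   one type is equivalent to a basis of l_1. *)
Lemma small_nondense_subset (Y : set X) : Y #= [set: k] ->
  exists Z, [/\ Z `<=` Y, Z #= Y & ~ linearly_dense Z].
Proof.
move=> Yk; apply: contrapT => nZ.
have {nZ} Yd Z : Z `<=` Y -> Z #= Y -> linearly_dense Z.
  by move=> ZY Zc; apply: contrapT => nd; apply: nZ; exists Z.
have [N [NC NS NO]] := small_oscillation eC.
(* The last component of [t] ranges over a countable type: the table [L] stands for the signs [s] on
   [F] and gives [None] at [i] itself. *)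
have /choice[G GP] (i : k) : exists t : X * seq k * (k -> bool) * (rat * rat * bool *
    seq (seq bool * option bool)),
    let: (y, F, s, (p, q, b, L)) := t in
    [/\ Y y, p < q,
    forall m, N m -> signs_on e (i :: F) (sign_upd s i b) m -> ratr q <= m y,
    forall m, N m -> signs_on e (i :: F) (sign_upd s i (~~ b)) m -> m y <= ratr p &
    forall j, j \in i :: F -> prefix_lookup L (c j) = if j == i then None else Some (s j)].
  have [y [F [s [p [q [b [Yy pq qy yp]]]]]]] := gap_exists C0 NC NS NO i (Yd _ (@subset_refl _ _) (card_eqxx _)).
  have [L LP] := prefix_lookup_surj (i :: F) (fun j => if j == i then None else Some (s j)) ci.
  by exists (y, F, s, (p, q, b, L)).
have [n nB] := kp (fun i => pickle (G i).2).
pose B := (fun i => pickle (G i).2) @^-1` [set n].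
have iB : infinite_set B.
  by move=> fB; apply: ki; exact: card_le_finite nB fB.
have [a Ba] := infinite_setN0 iB.
have [p [q [b [L GB]]]] : exists p q b L, forall i, B i -> (G i).2 = (p, q, b, L).
  move: Ba; rewrite /B /=; case: (G a).2 => [[[p q] b] L] Ba.
  exists p, q, b, L => i; rewrite /B /= -Ba => /(pcan_inj pickleK).
  by [].
pose y i := (G i).1.1.1.
have yP i : B i -> Y (y i) /\ p < q.
  by move=> /GB; have := GP i; rewrite /y; case: (G i) => [[[y' F] s] d] + /= de;
    rewrite de => -[].
have pq : p < q := (yP a Ba).2.
have real (l : seq k) (t : k -> bool) : (forall i, i \in l -> B i) ->
    exists2 m, N m & forall i, i \in l -> if t i then ratr q <= m (y i) else m (y i) <= ratr p.
  (* Patterns of different members of [B] are compatible because all are read off the same [L]. The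
     members themselves get [None], so their signs remain free and are set from [t] and [b]. *)
  move=> lB; pose s j := if prefix_lookup L (c j) is Some v then v else t j == b.
  have [m Nm mF] := NS (flatten [seq i :: (G i).1.1.2 | i <- l]) s.
  exists m => // i il; have := GP i; have := GB _ (lB _ il); rewrite /y.
  have := mF; move: (map_f (fun i => i :: (G i).1.1.2) il).
  case: (G i) => [[[yi F] si] d] /= lF {}mF -> [_ _ qy yp LP].
  have on b' : b' = (t i == b) -> signs_on e (i :: F) (sign_upd si i b') m.
    move=> b'E j jF; rewrite mF; last by apply/flattenP; exists (i :: F).
    rewrite /s LP// /sign_upd; case: eqVneq => [->|//].
    by rewrite b'E.
  case ti : (t i).
    by apply: qy => //; apply: on; rewrite ti; case: (b).
  by apply: yp => //; apply: on; rewrite ti; case: (b).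
(* Subtracting the functional for the opposite pattern removes the levels [p] and [q] and leaves
   differences of known sign. *)
have real2 (l : seq k) (t : k -> bool) : (forall i, i \in l -> B i) ->
    exists m m', [/\ dual_ball C m, dual_ball C m' & forall i, i \in l ->
      if t i then ratr q - ratr p <= m (y i) - m' (y i)
      else m (y i) - m' (y i) <= 0].
  move=> lB; have [m Nm mP] := real l t lB; have [m' Nm' m'P] := real l (fun i => ~~ t i) lB.
  exists m, m'; split; [exact: NC|exact: NC|] => i il.
  have := mP i il; have := m'P i il; have : ratr p < ratr q :> R by rewrite ltr_rat.
  by case: (t i) => /=; lra.
have qp : 0 < ratr q - ratr p :> R by rewrite subr_gt0 ltr_rat.
have yi i j : B i -> B j -> y i = y j -> i = j.
  move=> Bi Bj yij; apply: contrapT => /eqP ij.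
  have [|m [m' [_ _ mP]]] := real2 [:: i; j] (fun x => x == i).
    by move=> l; rewrite !inE => /orP[]/eqP ->.
  have := mP i; have := mP j; rewrite !inE !eqxx orbT eq_sym (negbTE ij) yij => /(_ isT) + /(_ isT).
  by lra.
pose Z := y @` (B `\ a).
have ZY : Z `<=` Y by move=> _ [i [Bi _] <-]; exact: (yP i Bi).1.
have Zd : linearly_dense Z.
  apply: Yd => //; apply/card_eqPle; split; first exact: subset_card_le.
  rewrite (card_le_eql Yk); apply: (card_le_trans nB); apply: (card_le_trans (card_le_setD1 a iB)).
  by apply: (@card_le_fun _ _ _ _ y) => [i j [Bi _] [Bj _]|i Bi]; [exact: yi|exists i].
have r0 : 0 < (ratr q - ratr p) / (4 * C) by rewrite divr_gt0// mulr_gt0.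
have [_ [d [w [z [zZ ->]]]] av] := linearly_dense_approx (y a) Zd r0.
have /choice[f fP] (i : 'I_d) : exists x, (B `\ a) x /\ y x = z i.
  by have [x Bx xz] := zZ i; exists x.
(* The difference is made large at [a] and, at every other index, of sign opposite to its total
   coefficient, so the combination cannot follow [y a]. Coefficients are added up over equal [f i],
   as points may repeat. *)
pose t x := (x == a) || (\sum_(i | f i == x) w i < 0).
have [|m [m' [mC m'C mP]]] := real2 (a :: codom f) t.
  by move=> x; rewrite inE => /predU1P[->//|/codomP[i ->]]; exact: (fP i).1.1.
have sum_le0 : \sum_i w i * (m (z i) - m' (z i)) <= 0.
  rewrite (partition_big (fun i => SeqSub (codom_f f i)) predT)//=.
  apply: sumr_le0 => x _.
  have xE i : (SeqSub (codom_f f i) == x) = (f i == val x) by [].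
  under eq_bigl do rewrite xE.
  rewrite (eq_bigr (fun i => w i * (m (y (val x)) - m' (y (val x))))); last first.
    by move=> i /eqP <-; rewrite (fP i).2.
  rewrite -mulr_suml; have := mP (val x); rewrite inE (valP x) orbT => /(_ isT).
  have xa : val x != a.
    by have /codomP[i ->] := valP x; apply/eqP => fia; exact: (fP i).1.2.
  rewrite /t (negbTE xa) /=; case: ltP => [lt0|ge0].
    by move=> h; rewrite mulr_le0_ge0// ?ltW// (lt_le_trans qp).
  by move=> h; rewrite mulr_ge0_le0.
have := mP a; rewrite mem_head /t eqxx => /(_ isT) /= ha.
have up g : dual_ball C g -> `|g (y a - \sum_i w i *: z i)| <= (ratr q - ratr p) / 4.
  move=> gC; rewrite (le_trans (gC.2 _))// -ler_pdivlMl// (le_trans (ltW av))//.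
  by rewrite invfM mulrA mulrC.
move: sum_le0; under eq_bigr do rewrite mulrBr.
rewrite sumrB => sum_le0; apply: (gap_absurd qp ha sum_le0).
  by have := up _ mC; rewrite (dual_ballB mC) (dual_ball_sum mC).
by have := up _ m'C; rewrite (dual_ballB m'C) (dual_ball_sum m'C).
Qed.

End core.

(** * Operators to bounded sequences *)

Section bounded_sequences.
Local Open Scope card_scope.
Context {R : realType}.
Local Notation loo := (linf R nat).

Lemma linf_of_proof (I : Type) (f : I -> R) : bounded_fct f -> f \in @linf_pred R I.
Proof. by move=> bf; exact/asboolP. Qed.

Definition linf_of (I : Type) (f : I -> R) (bf : bounded_fct f) : linf R I :=
  exist _ f (linf_of_proof bf).

Lemma linf_ub (I : Type) (f : linf R I) i : `|val f i| <= `|f|.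
Proof. by rewrite linf_normE; exact: sup_norm_ub (linf_bounded f). Qed.

Lemma linf_le (I : Type) (f : linf R I) M : 0 <= M -> (forall i, `|val f i| <= M) -> `|f| <= M.
Proof. by rewrite linf_normE; exact: sup_norm_le. Qed.

Lemma linf_eval_dual_ball (I : Type) (i : I) : dual_ball 1 (fun f : linf R I => val f i).
Proof. by split=> [//|f]; rewrite mul1r; exact: linf_ub. Qed.

Lemma bounded_fct_bool (I : Type) (w : I -> bool) : bounded_fct (fun i => (w i)%:R : R).
Proof. by exists 1 => i; case: (w i); rewrite ?normr1 ?normr0. Qed.

(** Uses an independent family of continuum many sets of integers: [b x] marks the codes of the
    tables with value [Some true] at [x], and evaluation at a code realises a finite sign
    pattern. *)
Lemma linf_nondense_subset (W : set loo) : W #= [set: nat -> bool] ->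
  exists Z, [/\ Z `<=` W, Z #= W & ~ linearly_dense Z].
Proof.
pose b (x : nat -> bool) n := if unpickle n is Some L then prefix_lookup L x == Some true else false.
apply: (@small_nondense_subset R loo (nat -> bool) id _ _ _ (fun x => linf_of (bounded_fct_bool (b x))) 1).
- by [].
- by move=> fc; apply: cantor_uncountable; exact: finite_set_countable.
- exact: cantor_pigeonhole.
- by [].
- move=> F s.
  have [L LF] := prefix_lookup_surj F (fun x => Some (s x)) (@inj_id (nat -> bool)).
  exists (fun f : loo => val f (pickle L)); first exact: linf_eval_dual_ball.
  by move=> x xF; rewrite /= /b pickleK LF//; case: (s x).
Qed.

(** Indicators of distinct sets are at distance 1, so the finite rational combinations of [W] within
    1/2 of them are distinct. A finite [W] has only countably many such combinations, an infinite
    [W] at most as many as its points. *)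
Lemma card_linearly_dense_linf (W : set loo) : linearly_dense W ->
  [set: nat -> bool] #<= W.
Proof.
move=> dW; pose comb (l : seq (rat * loo)) := \sum_(p <- l) ratr p.1 *: p.2 : loo.
have /choice[l lP] (w : nat -> bool) : exists l, (forall p, p \in l -> W p.2) /\
    `|linf_of (bounded_fct_bool w) - comb l| < 2^-1.
  have h0 : 0 < 4^-1 :> R by rewrite invr_gt0.
  have [_ [n [a [z [zW ->]]]] av] := linearly_dense_approx (linf_of (bounded_fct_bool w)) dW h0.
  (* The [n] rounding errors then add up to at most 1/4. The 1 added to the norm of [z i] avoids a
     division by zero. *)
  have /choice[q qP] (i : 'I_n) : exists q : rat, `|(a i - ratr q) *: z i| <= (4 * n.+1%:R)^-1.
    have r0 : 0 < (4 * n.+1%:R)^-1 / (`|z i| + 1) by rewrite divr_gt0 ?invr_gt0 ?mulr_gt0// ltr_wpDl.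
    have : a i - (4 * n.+1%:R)^-1 / (`|z i| + 1) < a i by rewrite ltrBlDr ltrDl.
    move=> /rat_in_itvoo[q]; rewrite in_itv/= => /andP[aq qa]; exists q.
    rewrite normrZ ger0_norm; last by rewrite subr_ge0 ltW.
    rewrite (@le_trans _ _ ((a i - ratr q) * (`|z i| + 1)))//.
      by apply: ler_wpM2l; [rewrite subr_ge0 ltW|rewrite lerDl].
    by rewrite -ler_pdivlMr ?ltr_wpDl// lerBlDr -lerBlDl; exact: ltW aq.
  exists [seq (q i, z i) | i <- enum 'I_n]; split; first by move=> p /mapP[i _ ->]; exact: zW.
  rewrite /comb big_map big_enum/= -(subrK (\sum_i a i *: z i) (linf_of _)) -addrA -sumrB.
  rewrite (le_lt_trans (ler_normD _ _))// [ltRHS](_ : _ = 4^-1 + 4^-1); last by field.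
  rewrite ltr_leD// (le_trans (ler_norm_sum _ _ _))//.
  under eq_bigr do rewrite -scalerBl.
  apply: (le_trans (ler_sum _ (fun i _ => qP i))).
  rewrite sumr_const card_ord -[leLHS]mulr_natl invfM mulrCA ler_piMr ?invr_ge0//.
  by rewrite ler_pdivrMr// mul1r ler_nat.
have li w w' : l w = l w' -> w = w'.
  move=> ll; apply/funext => n; have := (lP w).2; have := (lP w').2; rewrite -ll => h' h.
  have : `|linf_of (bounded_fct_bool w) - linf_of (bounded_fct_bool w')| < 1.
    rewrite -(subrK (comb (l w)) (linf_of (bounded_fct_bool w))) -addrA.
    rewrite (le_lt_trans (ler_normD _ _))// [ltRHS](_ : _ = 2^-1 + 2^-1); last by field.
    by rewrite ltrD// distrC.
  move/(le_lt_trans (linf_ub _ n)) => /=.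
  rewrite [X in `|X|](_ : _ = (w n)%:R - (w' n)%:R)//.
  by case: (w n) (w' n) => -[] //=; rewrite ?subr0 ?sub0r ?normrN ?normr1 ?ltxx.
have cl : [set: nat -> bool] #<= [set: seq (rat * W)].
  have pairP w (p : rat * loo) : p \in l w -> W p.2 by move: p; exact: (lP w).1.
  have /choice[g gP] w : exists g : seq (rat * W), [seq (p.1, val p.2) | p <- g] = l w.
    elim: (l w) (pairP w) => [_|p t ih tW]; first by exists [::].
    have [|g <-] := ih; first by move=> u ut; apply: tW; rewrite inE ut orbT.
    by exists ((p.1, SigSub (mem_set (tW p (mem_head _ _)))) :: g) => /=; rewrite -surjective_pairing.
  apply: (@card_le_funT _ _ g) => w w' gg; apply: li.
  by rewrite -!gP gg.
apply: (card_le_trans cl); have [fW|iW] := pselect (finite_set W).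
  exfalso; apply: cantor_uncountable; apply: (card_le_trans cl).
  have : countable [set: W] by rewrite (eq_countable (card_set_type W)); exact: finite_set_countable.
  move=> /Pcountable[W' ->]; exact: countableP.
apply: card_seq_le => //; rewrite -setXTT; apply: card_prod_le => //.
  by apply: (@card_le_trans _ _ _ [set: nat]); [exact: countableP|exact/infiniteP].
by rewrite (card_le_eql (card_set_type W)).
Qed.

End bounded_sequences.

(** * Operators with dense range in the bounded sequences *)

Section operator_to_linf.
Local Open Scope card_scope.
Context {R : realType} {X : normedModType R}.
Local Notation loo := (linf R nat).
Context (C : R) (C0 : 0 < C) (phi : nat -> X -> R).
Hypothesis phiC : forall n, dual_ball C (phi n).
Hypothesis phi_surj : forall w : nat -> bool, exists x, forall n, phi n x = (w n)%:R.

Let phi_bounded x : bounded_fct (phi^~ x).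
Proof. by exists (C * `|x|) => n; exact: (phiC n).2. Qed.

Let S x : loo := linf_of (phi_bounded x).

Let S_lin_span (Z : set X) v : lin_span Z v -> lin_span (S @` Z) (S v).
Proof.
move=> [n [a [z [Zz ->]]]]; exists n, a, (S \o z); split=> [i|]; first by exists (z i).
apply/val_inj/funext => j; transitivity (\sum_i a i * phi j (z i)).
  exact: (dual_ball_sum (phiC j)).
exact/esym/(dual_ball_sum (linf_eval_dual_ball j) a (S \o z)).
Qed.

(* Successive halving: |g| <= M implies |g - (M w - M/2)| <= M/2, where w is the
   indicator of g >= 0. *)
Let S_dense_range n : forall (M : R) (g : loo), 0 <= M -> (forall i, `|val g i| <= M) ->
  exists x, forall i, `|val g i - phi i x| <= M / 2 ^+ n.
Proof.
elim: n => [|n ih] M g M0 gM.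
  by exists 0 => i; rewrite (dual_ball0 (phiC i)) subr0 expr0 divr1.
have [x xP] := phi_surj (fun i => 0 <= val g i).
have [y yP] := phi_surj (fun=> true).
pose h := g - S (M *: x - (M / 2) *: y).
have hE i : val h i = val g i - (M * (0 <= val g i)%R%:R - M / 2).
  rewrite [LHS]/(val g i - phi i (M *: x - (M / 2) *: y)).
  by rewrite (dual_ballB (phiC i)) !(dual_ballZ (phiC i)) xP yP mulr1.
have [|i|z zP] := ih (M / 2) h; first by rewrite divr_ge0.
  rewrite hE; have := gM i; rewrite !ler_norml => /andP[? ?].
  by case: (leP 0 (val g i)) => ?; rewrite ?mulr1 ?mulr0; apply/andP; split; lra.
exists (M *: x - (M / 2) *: y + z) => i; have := zP i; rewrite hE.
rewrite (dual_ballD (phiC i)) (dual_ballB (phiC i)) !(dual_ballZ (phiC i)) xP yP mulr1.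
move=> h1; rewrite exprS invfM mulrA; apply: le_trans h1.
by rewrite le_eqVlt; apply/orP; left; apply/eqP; congr (`|_|); ring.
Qed.

Let S_linearly_dense (Z : set X) : linearly_dense Z -> linearly_dense (S @` Z).
Proof.
move=> dZ U [g Ug] oU; have /nbhs_ballP[r /= r0 rU] := open_nbhs_nbhs (conj oU Ug).
have [n nr] : exists n, `|g| / 2 ^+ n < r / 2.
  have [n nP] : exists n : nat, `|g| / (r / 2) < n%:R.
    exists (Num.truncn (`|g| / (r / 2))).+1; exact: truncnS_gt.
  exists n; rewrite ltr_pdivrMr ?exprn_gt0// mulrC -ltr_pdivrMr ?divr_gt0//.
  by rewrite (lt_trans nP)// -natrX ltr_nat ltn_expl.
have [x xP] := S_dense_range n (normr_ge0 g) (linf_ub g).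
have [v Zv xv] := linearly_dense_approx x dZ (divr_gt0 (divr_gt0 r0 (ltr0n _ 2)) C0).
exists (S v); split; last exact: S_lin_span.
apply: rU; rewrite -ball_normE /= -(subrK (S x) g) -addrA (le_lt_trans (ler_normD _ _))//.
rewrite [ltRHS]splitr ltr_leD//.
  by apply: le_lt_trans nr; apply: linf_le => //; rewrite divr_ge0 ?exprn_ge0.
apply: linf_le => [|i]; first by rewrite ltW// divr_gt0.
have -> : val (S x - S v) i = phi i (x - v) by rewrite (dual_ballB (phiC i)).
rewrite (le_trans ((phiC i).2 _))//.
by rewrite mulrC -ler_pdivlMr// ltW.
Qed.

Lemma linearly_denseS (V : normedModType R) (A B : set V) : A `<=` B ->
  linearly_dense A -> linearly_dense B.
Proof.
move=> AB dA U U0 oU; have [v [Uv [n [a [z [zA vE]]]]]] := dA U U0 oU.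
by exists v; split => //; exists n, a, z; split => // i; exact/AB/zA.
Qed.

Theorem operator_to_linf_no_overcomplete : ~ admits_overcomplete X.
Proof.
move=> [Y [_ Yd]].
have leY (Z : set X) : Z `<=` Y -> Y #<= Z -> linearly_dense (S @` Z).
  by move=> ZY YZ; apply/S_linearly_dense/Yd => //; apply/card_eqPle; split => //; exact: subset_card_le.
have iY : infinite_set Y.
  move=> fY; apply: cantor_uncountable; apply: (@card_le_trans _ _ _ (S @` Y)).
    by apply/card_linearly_dense_linf/leY.
  by apply: finite_set_countable; exact: finite_image.
have [W WY Wreg] := regular_image S iY.
have Wd V : V `<=` W -> V #= W -> linearly_dense V.
  move=> VW /(Wreg _ VW) /leY h; apply: linearly_denseS (h _) => //.
  by move=> _ [y [_ Vy] <-].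
(* [W] has at least continuum many points because it is linearly dense, and at most as many because
   the whole sequence space has no more. *)
have Wc : W #= [set: nat -> bool].
  apply/card_eqPle; split; last exact/card_linearly_dense_linf/Wd.
  apply: card_le_trans (card_realseq R).
  by apply: (@card_le_fun _ _ _ _ val) => // x y _ _ /val_inj.
have [Z [ZW Zc]] := linf_nondense_subset Wc.
by apply; exact: Wd.
Qed.

End operator_to_linf.

(** * Copies of l_1 *)

Section hahn_banach.
Context {R : realType} {V : lmodType R}.
Implicit Types (p q : V -> R).

Definition sublinear q := (forall x y, q (x + y) <= q x + q y) /\
  forall (s : R) x, 0 <= s -> q (s *: x) <= s * q x.

Lemma sublinear0 q : sublinear q -> q 0 = 0.
Proof.
move=> [qD qZ]; apply/le_anti/andP; split.
  by have := qZ 0 0 (lexx _); rewrite scale0r mul0r.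
by have := qD 0 0; rewrite addr0 -lerBlDr subrr.
Qed.

Lemma sublinear_ge q x : sublinear q -> - q (- x) <= q x.
Proof.
move=> qs; rewrite -subr_ge0 opprK -(sublinear0 qs) -(subrr x).
exact: qs.1.
Qed.

(** The common tool for lower bounds of chains, for the minimality argument and for extension from a
    span: the family has to be closed under sums and multiples only up to an inequality. *)
Lemma inf_sublinear (I : Type) (i0 : I) (f : I -> V -> R) (l : V -> R) :
  (forall i x, l x <= f i x) ->
  (forall i j x y, exists h, f h (x + y) <= f i x + f j y) ->
  (forall i (s : R) x, 0 <= s -> exists h, f h (s *: x) <= s * f i x) ->
  exists2 q, sublinear q & forall x, l x <= q x /\ forall i, q x <= f i x.
Proof.
move=> fl fD fZ; pose q x := inf (range (f^~ x)).
have qle x i : q x <= f i x.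
  by apply: ge_inf; [exists (l x) => _ [j _ <-]|exists i].
have q_ge x M : (forall i, M <= f i x) -> M <= q x.
  by move=> Mf; apply: lb_le_inf => [|_ [i _ <-]//]; exists (f i0 x), i0.
exists q => [|x]; last by split=> [|i]; [exact: q_ge|exact: qle].
split=> [x y|s x s0].
  rewrite -lerBlDr; apply: (q_ge) => i; rewrite lerBlDr -lerBlDl. apply: (q_ge) => j.
  have [h fh] := fD i j x y; rewrite lerBlDl.
  exact: le_trans (qle _ h) fh.
have [->|s_neq0] := eqVneq s 0.
  rewrite scale0r mul0r -(scale0r 0); have [h] := fZ i0 0 0 (lexx _).
  by rewrite mul0r; exact: le_trans (qle _ _).
have s_gt0 : 0 < s by rewrite lt_def s_neq0.
rewrite -ler_pdivrMl//; apply: (q_ge) => i; rewrite ler_pdivrMl//.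
by have [h] := fZ i s x s0; exact: le_trans (qle _ _).
Qed.

(* A minimal sublinear functional q is linear: for each y it coincides with
   x |-> inf_(t >= 0) (q (x + t y) - t q y), whence q (- y) = - q y. *)
Lemma hahn_banach p : sublinear p ->
  exists2 m : V -> R, (forall a x y, m (a *: x + y) = a * m x + m y) & forall x, m x <= p x.
Proof.
move=> ps; pose T := {q | sublinear q /\ forall x, q x <= p x}.
(* The order is reversed, so that a maximal element is a minimal sublinear functional. *)
pose ge (q q' : T) := `[< forall x, sval q' x <= sval q x >].
have [|||A Atot|[q [qs qp]] qmin] := @Zorn T ge.
- by move=> q; apply/asboolP.
- move=> q1 q2 q3 /asboolP h1 /asboolP h2; apply/asboolP => x.
  exact: le_trans (h2 x) (h1 x).
- move=> [q1 h1] [q2 h2] /asboolP/= h12 /asboolP/= h21; apply: eq_exist; apply/funext => x.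
  by apply: le_anti; rewrite h12 h21.
- have [[q0 Aq0]|A0] := pselect (A !=set0); last first.
    by exists (exist _ p (conj ps (fun x => lexx (p x)))) => q Aq; case: A0; exists q.
  have [|||q qs qP] := @inf_sublinear {q : T | A q} (exist _ q0 Aq0)
    (fun (q : {q : T | A q}) => sval (sval q)) (fun x => - p (- x)).
  + move=> [[q [qs qp]] Aq] x /=; apply: le_trans (sublinear_ge x qs).
    by rewrite lerN2.
  + move=> [q1 A1] [q2 A2] x y; have [/asboolP h|/asboolP h] := Atot _ _ A1 A2.
      exists (exist _ q2 A2) => /=; case: (svalP q2) => [[qD _] _].
      by rewrite (le_trans (qD x y))// lerD.
    exists (exist _ q1 A1) => /=; case: (svalP q1) => [[qD _] _].
    by rewrite (le_trans (qD x y))// lerD.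
  + move=> [q1 A1] s x s0; exists (exist _ q1 A1) => /=.
    by case: (svalP q1) => [[_ qZ] _]; exact: qZ.
  have qp x : q x <= p x.
    have := (qP x).2 (exist _ q0 Aq0) => /= /le_trans; apply.
    by case: (svalP q0) => _; exact.
  exists (exist _ q (conj qs qp)) => q1 A1; apply/asboolP => x /=.
  exact: (qP x).2 (exist _ q1 A1).
have odd y : q (- y) = - q y.
  have [qD qZ] := qs.
  have [||| q' q's q'P] := @inf_sublinear {t : R | 0 <= t} (exist _ 0 (lexx 0))
    (fun (t : {t : R | 0 <= t}) x => q (x + sval t *: y) - sval t * q y) (fun x => - q (- x)).
  - move=> [t t0] x /=; rewrite lerBrDr addrC lerBlDr.
    have tq : t * q y <= q (t *: y).
      have [->|t_neq0] := eqVneq t 0; first by rewrite mul0r scale0r (sublinear0 qs).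
      have t_gt0 : 0 < t by rewrite lt_def t_neq0.
      rewrite -ler_pdivlMl// -{1}(scalerK t_neq0 y); apply: qZ.
      by rewrite invr_ge0.
    apply: (le_trans tq); have := qD (x + t *: y) (- x).
    by rewrite addrAC subrr add0r.
  - move=> [t t0] [u u0] x x'; exists (exist _ (t + u) (addr_ge0 t0 u0)) => /=.
    have := qD (x + t *: y) (x' + u *: y).
    rewrite addrACA -scalerDl mulrDl; lra.
  - move=> [t t0] s x s0; exists (exist _ (s * t) (mulr_ge0 s0 t0)) => /=.
    have := qZ s (x + t *: y) s0.
    by rewrite scalerDr scalerA mulrBr mulrA lerBlDr subrK.
  have q'q x : q' x <= q x.
    by have := (q'P x).2 (exist _ 0 (lexx 0)); rewrite /= scale0r addr0 mul0r subr0.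
  have q'E : q' = q.
    have := qmin (exist _ q' (conj q's (fun x => le_trans (q'q x) (qp x)))).
    by move=> /(_ (asboolT q'q)) /(congr1 sval).
  (* The member [t = 1] of the family, evaluated at [- y], gives [q (- y) <= q 0 - q y]. *)
  apply: le_anti; rewrite -{1}q'E; apply/andP; split.
    have := (q'P (- y)).2 (exist _ 1 ler01).
    by rewrite /= scale1r addNr (sublinear0 qs) mul1r sub0r.
  by have := sublinear_ge (- y) qs; rewrite opprK.
have qD x y : q (x + y) = q x + q y.
  apply: le_anti; rewrite qs.1 /=; have := qs.1 (- x) (- y).
  by rewrite -opprD !odd -opprD lerN2.
have qZ a x : q (a *: x) = a * q x.
  have pos (b : R) z : 0 <= b -> q (b *: z) = b * q z.
    move=> b0; apply: le_anti; rewrite qs.2//=; have := qs.2 b (- z) b0.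
    by rewrite scalerN !odd mulrN lerN2.
  have [a0|a0] := leP 0 a; first exact: pos.
  rewrite -[a]opprK scaleNr odd pos ?mulNr// oppr_ge0; exact: ltW.
by exists q => // a x y; rewrite qD qZ.
Qed.

End hahn_banach.

(** * Functionals with prescribed values on an l_1 basis *)

Section l1_family.
Context {R : realType} {X : normedModType R} {k : eqType} (e : k -> X) (c : R).
Hypothesis c0 : 0 < c.
Hypothesis e_l1 : forall (l : seq (R * k)) (w : k -> R), (forall i, `|w i| <= 1) ->
  c * (\sum_(t <- l) t.1 * w t.2) <= `|\sum_(t <- l) t.1 *: e t.2|.

(** The infimum of [f l] over all finite combinations is sublinear, and [e_l1] bounds it from below.
    A linear functional under it has norm at most [c^-1], by the empty combination, and is at most
    [w i] at [e i] and [- w i] at [- e i], by one-term combinations. *)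
Lemma l1_family_functional (w : k -> R) : (forall i, `|w i| <= 1) ->
  exists2 m, dual_ball c^-1 m & forall i, m (e i) = w i.
Proof.
move=> w1; pose ev (l : seq (R * k)) := \sum_(t <- l) t.1 *: e t.2.
pose wv (l : seq (R * k)) := \sum_(t <- l) t.1 * w t.2.
pose sc (s : R) (l : seq (R * k)) := [seq (s * t.1, t.2) | t <- l].
have evZ s l : ev (sc s l) = s *: ev l.
  by rewrite /ev big_map scaler_sumr; apply: eq_bigr => t _; rewrite scalerA.
have wvZ s l : wv (sc s l) = s * wv l.
  by rewrite /wv big_map mulr_sumr; apply: eq_bigr => t _; rewrite mulrA.
pose f l x := c^-1 * `|x - ev l| + wv l.
have ci0 : 0 <= c^-1 by rewrite invr_ge0 ltW.
have [|||p ps pP] := @inf_sublinear R X _ [::] f (fun x => - (c^-1 * `|x|)).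
- move=> l x; have := e_l1 (sc (-1) l) w1; rewrite -/(ev _) -/(wv _) evZ wvZ.
  rewrite -ler_pdivlMl// mulN1r scaleN1r normrN => h.
  rewrite lerNl opprD addrC lerBlDr -mulrDr (le_trans h)// ler_wpM2l//.
  by rewrite -{1}(subKr x (ev l)) ler_normB.
- move=> l l' x y; exists (l ++ l').
  rewrite /f /ev /wv !big_cat/= addrACA lerD2r -mulrDr ler_wpM2l//.
  by rewrite opprD addrACA ler_normD.
- move=> l s x s0; exists (sc s l); rewrite /f evZ wvZ -scalerBr normrZ ger0_norm//.
  by rewrite mulrDr mulrCA.
have [m mL mp] := hahn_banach ps.
have m0 : m 0 = 0 by have := mL (-1) 0 0; rewrite scaleN1r oppr0 addr0 mulN1r addNr.
have mN x : m (- x) = - m x by have := mL (-1) x 0; rewrite scaleN1r mulN1r m0 !addr0.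
have mle x l : m x <= f l x := le_trans (mp x) ((pP x).2 l).
exists m => [|i].
  split=> // x; have h y : m y <= c^-1 * `|y|.
    by have := mle y [::]; rewrite /f /ev /wv !big_nil subr0 addr0.
  by rewrite ler_norml h andbT lerNl -mN -normrN h.
have h (s : R) : `|s| = 1 -> m (s *: e i) <= s * w i.
  move=> s1; have := mle (s *: e i) [:: (s, i)].
  by rewrite /f /ev /wv !big_seq1 subrr normr0 mulr0 add0r.
apply: le_anti; have := h 1; have := h (-1).
rewrite normrN normr1 scale1r scaleN1r mN mulN1r mul1r lerN2 => /(_ erefl) -> /(_ erefl) ->.
by [].
Qed.

End l1_family.

Section l1_basis.
Context {R : realType} {k : choiceType}.

Let basis_fun (i : k) : k -> R := fun j => (j == i)%:R.

Let basis_l1 i : basis_fun i \in @l1_pred R k.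
Proof.
apply/asboolP; rewrite /summable.
have -> : (fun j => `|(EFin \o basis_fun i) j|%E) =
    (fun j => if j \in [set i] then 1%E else 0%E :> \bar R).
  apply/funext => j /=; rewrite /basis_fun; have [->|ji] := eqVneq j i.
    by rewrite normr1 mem_set.
  by rewrite normr0 memNset// => ij; move: ji; rewrite ij eqxx.
by rewrite -esum_mkcond esum_set1// ltry.
Qed.

Definition l1_basis (i : k) : l1 R k := exist _ (basis_fun i) (basis_l1 i).

Lemma l1_norm_ge (g : l1 R k) (s : seq k) : uniq s -> \sum_(i <- s) `|val g i| <= `|g|.
Proof.
move=> us; rewrite l1_normE -lee_fin fineK; last first.
  rewrite ge0_fin_numE; last by apply: esum_ge0 => i _; rewrite lee_fin.
  by have /asboolP := valP g.
apply: esum_ge; exists [set` s]; first by split => //; exact: finite_seq.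
by rewrite -fsbig_seq// sumEFin.
Qed.

(** This is the lower estimate required of an l_1 family, with constant 1. Indices may repeat in
    [l], so coefficients are regrouped over the distinct ones. *)
Lemma l1_basis_family (l : seq (R * k)) (w : k -> R) : (forall i, `|w i| <= 1) ->
  \sum_(t <- l) t.1 * w t.2 <= `|\sum_(t <- l) t.1 *: l1_basis t.2|.
Proof.
move=> w1; pose g : l1 R k := \sum_(t <- l) t.1 *: l1_basis t.2; rewrite -/g.
have gE j : val g j = \sum_(t <- l) t.1 * (j == t.2)%:R.
  rewrite /g; elim: l {g} => [|t l ih]; first by rewrite !big_nil.
  by rewrite !big_cons -ih.
pose s := undup [seq t.2 | t <- l].
apply: le_trans (l1_norm_ge g (undup_uniq [seq t.2 | t <- l])).
rewrite -/s (_ : \sum_(t <- l) t.1 * w t.2 = \sum_(j <- s) val g j * w j).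
  apply: ler_sum => j _; rewrite (le_trans (ler_norm _))// normrM.
  by rewrite ler_piMr.
under [RHS]eq_bigr do rewrite gE mulr_suml.
rewrite exchange_big/= big_seq [RHS]big_seq; apply: eq_bigr => t tl.
have ts : t.2 \in s by rewrite mem_undup map_f.
rewrite (big_rem t.2)//= eqxx mulr1 big1_seq ?addr0// => j /andP[_].
rewrite rem_filter ?undup_uniq// mem_filter => /andP[/= /negbTE -> _].
by rewrite mulr0 mul0r.
Qed.

End l1_basis.

(** * Spaces containing a copy of l_1(kappa) *)

Section density.
Local Open Scope card_scope.

Lemma has_density_unique (R : realType) (X : normedModType R) (U V : Type)
  (A : set U) (B : set V) : has_density X A -> has_density X B -> A #= B.
Proof.
move=> [[D1 d1 D1A] A1] [[D2 d2 D2B] B2]; apply/card_eqPle; split.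
  by rewrite -(card_le_eqr D2B); exact: A1.
by rewrite -(card_le_eqr D1A); exact: B2.
Qed.

Lemma uncountable_cofinality_infinite (K : Type) :
  uncountable_cofinality K -> infinite_set [set: K].
Proof.
move=> [r [wr _] cofK] fK; apply: (cofK setT); first exact: finite_set_countable.
by move=> x; exists x => //; exact: wo_refl.
Qed.

Theorem l1_copy_no_overcomplete (R : realType) (k : choiceType) (X : normedModType R) :
  uncountable_cofinality k -> has_density X [set: k] -> contains_copy (l1 R k) X ->
  ~ admits_overcomplete X.
Proof.
move=> kcof kX [f [c [C [c0 fcC]]]].
pose e i := f (l1_basis i).
have fun_ex (w : k -> R) : (forall i, `|w i| <= 1) ->
    exists2 m, dual_ball c^-1 m & forall i, m (e i) = w i.
  apply: l1_family_functional => // l w' w'1.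
  have -> : \sum_(t <- l) t.1 *: e t.2 = f (\sum_(t <- l) t.1 *: l1_basis t.2).
    by rewrite linear_sum; apply: eq_bigr => t _; rewrite linearZ.
  have /andP[h _] := fcC (\sum_(t <- l) t.1 *: l1_basis t.2).
  by apply: le_trans h; rewrite ler_pM2l//; exact: l1_basis_family.
have ci0 : 0 < c^-1 by rewrite invr_gt0.
have b1 (b : bool) : `|b%:R : R| <= 1 by case: b; rewrite ?normr1 ?normr0.
have [/card_leTP[j ji]|/card_leTP[j ji]] := card_le_total [set: k] [set: nat -> bool].
  move=> [Y [YX Yd]].
  have [|Z [ZY Zc]] := small_nondense_subset ji (uncountable_cofinality_infinite kcof)
      (fun f => uncountable_cofinality_pigeonhole f kcof) (e := e) ci0 _ (has_density_unique YX kX).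
    move=> F s; have [m mC mE] := fun_ex (fun i => (s i)%:R) (fun i => b1 _).
    by exists m => // i _; rewrite mE.
  by apply; exact: Yd.
(* [g] inverts [j] on its range. Prescribing the [n]-th bit of [g i] at each [e i] yields
   functionals with [phi n (e (j w)) = w n]. *)
have /choice[g gP] (i : k) : exists w : nat -> bool, forall v, j v = i -> w = v.
  have [[v vi]|nv] := pselect (exists v, j v = i); last by exists (fun=> true) => v vi; case: nv; exists v.
  by exists v => u; rewrite -vi => /ji.
have /choice[phi phiP] n : exists m, dual_ball c^-1 m /\ forall i, m (e i) = (g i n)%:R.
  by have [m mC mE] := fun_ex (fun i => (g i n)%:R) (fun i => b1 _); exists m.
apply: (operator_to_linf_no_overcomplete ci0 (phi := phi)); first by move=> n; exact: (phiP n).1.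
by move=> w; exists (e (j w)) => n; rewrite (phiP n).2 (gP _ w).
Qed.

End density.

(** * Concrete spaces *)

Section filter_limit.
Context {R : realType} {T : Type}.

(* A limit along an ultrafilter finer than F. *)
Lemma filter_limit (F : set_system T) : ProperFilter F -> exists L : (T -> R) -> R, [/\
  forall (a : R) f g (M N : R), F [set x | `|f x| <= M] -> F [set x | `|g x| <= N] ->
    L (fun x => a * f x + g x) = a * L f + L g,
  forall f (M : R), F [set x | `|f x| <= M] -> `|L f| <= M &
  forall f c, F [set x | f x = c] -> L f = c].
Proof.
move=> FF; have [G [GU FG]] := ultraFilterLemma FF.
have GP : ProperFilter G := @ultra_proper _ _ GU.
have conv f M : G [set x | `|f x| <= M] -> exists l : R, f @ G --> l.
  move=> fM; have [|l [_ cl]] := @segment_compact R (- M) M (f @ G) _.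
    by apply: (@filterS _ G _ _ _ _ fM) => x; rewrite /= in_itv/= -ler_norml.
  exists l => U lU; have [//|nU] := in_ultra_setVsetC (f @^-1` U) GU.
  have [|y [nUy Uy]] := cl (~` U) U _ lU; first exact: nU.
  by case: nUy.
exists (fun f => lim (f @ G)); split.
- move=> a f g M N /FG/conv[l fl] /FG/conv[l' gl'].
  have h : (fun x => a * f x + g x) @ G --> a * l + l'.
    apply: (@cvgD _ _ _ G _ (fun x => a * f x) g) gl'.
    by apply: (@cvgMl_tmp _ _ G _ f).
  by rewrite (cvg_lim _ h)// (cvg_lim _ fl)// (cvg_lim _ gl').
- move=> f M /FG fM; have [l fl] := conv _ _ fM; rewrite (cvg_lim _ fl)//.
  have [|l' [l'M cl]] := @segment_compact R (- M) M (f @ G) _.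
    by apply: (@filterS _ G _ _ _ _ fM) => x; rewrite /= in_itv/= -ler_norml.
  have <- : l' = l.
    apply: (@Rhausdorff R) => U V l'U lV; have [|y [Vy Uy]] := cl V U _ l'U; first exact: fl.
    by exists y.
  by move: l'M; rewrite /= in_itv/= -ler_norml.
- move=> f c /FG fc; apply: cvg_lim => //; apply: cvg_near_cst.
  exact: fc.
Qed.

End filter_limit.

Section linf_spaces.
Context {R : realType}.
Local Open Scope card_scope.

Lemma linf_no_overcomplete (I : Type) : infinite_set [set: I] ->
  ~ admits_overcomplete (linf R I).
Proof.
move=> /infiniteP/card_leTP[h hi].
apply: (operator_to_linf_no_overcomplete (@ltr01 R) (X := linf R I)
  (phi := fun n (f : linf R I) => val f (h n))).
  by move=> n; exact: linf_eval_dual_ball.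
move=> w; exists (linf_of (bounded_fct_bool (fun i => `[< exists2 n, h n = i & w n >]))) => n /=.
congr (_ _)%:R; apply/asboolP/idP => [[m /hi ->]//|wn].
by exists n.
Qed.

(** The points [h (pickle (n, k))] form disjoint sequences, one for each [n]. Limits along
    ultrafilters on them vanish on c_0, so they define functionals on the quotient, and the
    indicator of a union of the sequences realises a given [w]. *)
Lemma linf_mod_c0_no_overcomplete (I : Type) : infinite_set [set: I] ->
  ~ admits_overcomplete (linf_mod_c0 R I).
Proof.
move=> /infiniteP/card_leTP[h hi].
pose F (n : nat) : set_system I := (fun k : nat => h (pickle (n, k))) @ \oo.
have FF n : ProperFilter (F n) by exact: fmap_proper_filter.
have /choice[L LP] n := @filter_limit R _ (F n) (FF n).
have hinj (n k m l : nat) : h (pickle (n, k)) = h (pickle (m, l)) -> n = m /\ k = l.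
  by move=> /hi/(pcan_inj pickleK)[].
have bnd n (f : linf R I) : F n [set x | `|val f x| <= `|f|].
  by exists 0%N => // k _; exact: linf_ub.
have Llin n a (f g : linf R I) : L n (val (a *: f + g)) = a * L n (val f) + L n (val g).
  by have [h1 _ _] := LP n; exact: (h1 a (val f) (val g) _ _ (bnd n f) (bnd n g)).
have L0 n (f : linf R I) : f \in @c0_pred R I -> L n (val f) = 0.
  move=> /asboolP fc; apply/eqP; rewrite -normr_le0; apply/ler_addgt0Pl => e e0.
  rewrite addr0; have [_ h2 _] := LP n; apply: h2.
  have fin : finite_set [set k : nat | e <= `|val f (h (pickle (n, k)))|].
    apply: (card_le_finite _ (fc e e0)).
    by apply: (@card_le_fun _ _ _ _ (fun k : nat => h (pickle (n, k)))) => // k l _ _ /hinj[].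
  have [N NP] : exists N, forall k : nat, (N <= k)%N -> ~ e <= `|val f (h (pickle (n, k)))|.
    have /finite_seqP[s sE] := fin.
    exists (\max_(i <- s) i).+1 => k Nk ek.
    have : k \in s by have : [set` s] k by rewrite -sE.
    by move=> /(@leq_bigmax_seq _ s xpredT id) /(_ isT); rewrite leqNgt Nk.
  by exists N => // k /NP /negP; rewrite -ltNge => /ltW.
have Lrepr n (f : linf R I) : L n (val (repr (\pi_(lmod_quot (@c0_submod R I))%qT f))) = L n (val f).
  have := Llin n 1 (repr (\pi_(lmod_quot (@c0_submod R I))%qT f) - f) f.
  rewrite scale1r subrK mul1r => ->; rewrite L0 ?add0r//; exact: repr_lmod_quot.
apply: (operator_to_linf_no_overcomplete (@ltr01 R) (X := linf_mod_c0 R I)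
  (phi := fun n q => L n (val (repr q)))).
  move=> n; split=> [a x y|x].
    have <- : \pi_(lmod_quot (@c0_submod R I))%qT (a *: repr x + repr y) = a *: x + y.
      by rewrite raddfD /= pi_scale !reprK.
    by rewrite Lrepr Llin.
  rewrite mul1r -[x in leRHS]reprK linf_mod_c0_normE; apply: lb_le_inf.
    by exists `|repr x - 0|, 0 => //; exact: (@c0_submod R I).1.
  move=> _ [g /= gc <-]; have := Llin n 1 (repr x - g) g.
  rewrite scale1r subrK mul1r => ->; rewrite (L0 n g gc) addr0.
  by have [_ h2 _] := LP n; exact: h2 (bnd n _).
move=> w; pose A i := `[< exists n k : nat, h (pickle (n, k)) = i /\ w n >].
exists (\pi_(lmod_quot (@c0_submod R I))%qT (linf_of (bounded_fct_bool A))) => n.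
rewrite Lrepr; have [_ _ h3] := LP n; apply: h3; exists 0%N => // k _ /=.
congr (_ _)%:R; apply/asboolP/idP => [[m [l [/hinj[-> _] //]]]|wn].
by exists n, k.
Qed.

End linf_spaces.

Section continuous_functions.
Context {R : realType} {K : topologicalType} (cK : compact [set: K]).

Lemma cspace_of_proof (f : K -> R) : continuous f -> f \in @continuous_pred R K.
Proof. by move=> cf; exact/asboolP. Qed.

Definition cspace_of (f : K -> R) (cf : continuous f) : cspace R cK :=
  exist _ f (cspace_of_proof cf).

Lemma cspace_bounded (f : cspace R cK) : bounded_fct (val f).
Proof. by apply: continuous_bounded => //; apply/asboolP; exact: (valP f). Qed.

Lemma cspace_eval_dual_ball (x : K) : dual_ball 1 (fun f : cspace R cK => val f x).
Proof.
by split=> [//|f]; rewrite mul1r cspace_normE; exact/sup_norm_ub/cspace_bounded.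
Qed.

End continuous_functions.

(** * Extremally disconnected compact spaces *)

Section extremally_disconnected.
Context {R : realType} (K : topologicalType) (cK : compact [set: K]).
Hypothesis hK : hausdorff_space K.
Hypothesis eK : extremally_disconnected K.

Lemma indicator_continuous (A : set K) : clopen A ->
  continuous (fun x => (`[< A x >])%:R : R).
Proof.
move=> [oA cA] x; apply: cvg_near_cst.
have [Ax|nAx] := pselect (A x).
  apply: filterS (open_nbhs_nbhs (conj oA Ax)) => y Ay.
  by rewrite !asboolT.
have /open_nbhs_nbhs : open_nbhs x (~` A) by split => //; exact: closed_openC.
by apply: filterS => y nAy; rewrite !asboolF.
Qed.

(** Two points of [W] are separated by disjoint open sets, and the closure of one of these is
    clopen. It cuts [W] into two nonempty clopen pieces, one of them infinite; the other piece is
    [U]. *)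
Let split_clopen (W : set K) : clopen W -> infinite_set W -> exists U,
  [/\ open U, U !=set0, U `<=` W, clopen (W `\` U) & infinite_set (W `\` U)].
Proof.
move=> [oW cW] iW; have [x Wx] := infinite_setN0 iW.
have [y [Wy yx]] := infinite_setN0 (infinite_setD iW (finite_set1 x)).
move: hK; rewrite open_hausdorff => /(_ y x) []; first by apply/eqP.
move=> [A B] /= [/set_mem Ay /set_mem Bx] [oA oB AB0].
have oclA := eK oA.
have clopen_clA : clopen (closure A) by split => //; exact: closed_closure.
have nclAx : ~ closure A x.
  move=> /(_ B (open_nbhs_nbhs (conj oB Bx)))[z ABz].
  by move: ABz; rewrite (eqP AB0).
have cl1 : clopen (W `&` closure A) by exact: clopenI.
have cl2 : clopen (W `\` closure A).
  by rewrite setDE; apply: clopenI => //; exact: clopenC.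
have [i1|f1] := pselect (infinite_set (W `\` closure A)).
  exists (W `&` closure A); rewrite setDIr setDv set0U; split => //.
  - exact: cl1.1.
  - by exists y; split => //; exact: subset_closure.
exists (W `\` closure A); rewrite setDD; split => //.
- exact: cl2.1.
- by exists x.
- move=> f2; apply: f1 => f1; apply: iW; rewrite -(setUIDK W (closure A)).
  by rewrite finite_setU.
Qed.

Let disjoint_opens : infinite_set [set: K] -> exists U : nat -> set K,
  [/\ forall n, open (U n), forall n, U n !=set0 &
      forall n m, U n `&` U m !=set0 -> n = m].
Proof.
move=> iK; have /choice[f fP] (W : set K) : exists U, clopen W -> infinite_set W ->
    [/\ open U, U !=set0, U `<=` W, clopen (W `\` U) & infinite_set (W `\` U)].
  have [[cW iW]|n] := pselect (clopen W /\ infinite_set W).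
    by have [U UP] := split_clopen cW iW; exists U.
  by exists set0 => cW iW; case: n.
pose W := fix W n := if n is m.+1 then W m `\` f (W m) else [set: K].
have WP n : clopen (W n) /\ infinite_set (W n).
  elim: n => [|n [cW iW]] /=; first by split=> //; split; [exact: openT|exact: closedT].
  by have [] := fP _ cW iW.
have WS n m : (n < m)%N -> W m `<=` W n `\` f (W n).
  elim: m => // m ih; rewrite ltnS leq_eqVlt => /predU1P[->//|/ih Wmn].
  by move=> x /= [/Wmn].
exists (fun n => f (W n)); split=> [n|n|n m [x [xn xm]]].
- by have [cW iW] := WP n; have [] := fP _ cW iW.
- by have [cW iW] := WP n; have [] := fP _ cW iW.
- have fW l : f (W l) `<=` W l by have [cW iW] := WP l; have [] := fP _ cW iW.
  apply/eqP; case: ltngtP => // [/WS WW|/WS WW].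
    by have [] := WW x (fW _ _ xm).
  by have [] := WW x (fW _ _ xn).
Qed.

(** The functionals are evaluations at points of disjoint open sets [U n]. The closure of the union
    of those with [w n] is clopen, and it misses every other [U m] since [U m] is open and disjoint
    from the union. *)
Theorem extremally_disconnected_no_overcomplete : infinite_set [set: K] ->
  ~ admits_overcomplete (cspace R cK).
Proof.
move=> /disjoint_opens[U [oU U0 Udisj]].
have /choice[p pU] n : exists x, U n x by exact: U0.
apply: (operator_to_linf_no_overcomplete (@ltr01 R) (X := cspace R cK)
  (phi := fun n (f : cspace R cK) => val f (p n))).
  by move=> n; exact: cspace_eval_dual_ball.
move=> w; pose A := closure (\bigcup_(n in [set n | w n]) U n).
have cA : clopen A.
  split; last exact: closed_closure.
  by apply: eK; apply: bigcup_open => n _.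
exists (cspace_of cK (indicator_continuous cA)) => n /=.
congr (_ _)%:R; apply/asboolP/idP => [|wn]; last first.
  by apply: subset_closure; exists n.
move=> /(_ (U n) (open_nbhs_nbhs (conj (oU n) (pU n))))[x [[m /= wm Umx] Unx]].
by rewrite (Udisj n m)//; exists x.
Qed.

End extremally_disconnected.

(** * Essentially bounded functions *)

Section essentially_bounded.
Context {d} {T : measurableType d} {R : realType}.
Context (mu : {measure set T -> \bar R}).
Local Notation Loo := (LfunType mu (leey 1)).

Lemma Loo_of_bool (A : set T) : measurable A ->
  exists f : Loo, forall x, f x = (`[< A x >])%:R.
Proof.
move=> mA; pose f x : R := (`[< A x >])%:R.
have mf : measurable_fun setT f.
  rewrite (_ : f = \1_A); first exact: measurable_indic.
  by apply/funext => x; rewrite /f indicE; congr (_ _)%:R; apply/asboolP/idP;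
    rewrite inE.
have fL : f \in Lfun mu +oo%E.
  apply/andP; split; first by rewrite inE.
  rewrite inE /= /finite_norm unlock /Lnorm; case: ifPn => [_|_]; last exact: ltry.
  apply: (@le_lt_trans _ _ 1%E); last exact: ltry.
  apply/ess_supP; apply: aeW => x /=.
  by rewrite lee_fin /f; case: asboolP; rewrite ?normr1 ?normr0.
by exists (Lfun_Sub (leey 1) fL).
Qed.

Lemma Loo_norm_ae (f : Loo) : (0 < mu setT)%E -> \forall x \ae mu, `|f x| <= Loo_norm f.
Proof.
move=> mu0; have := ess_sup_ge mu (abse \o (EFin \o f)); apply: filterS => x.
rewrite -lee_fin => /le_trans; apply; rewrite /Loo_norm finite_norm_fine.
by rewrite unlock /Lnorm mu0.
Qed.

Lemma Linf_no_overcomplete (a : nat -> set T) : (forall n, measurable (a n)) ->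
  trivIset setT a -> (forall n, (0 < mu (a n))%E) -> ~ admits_overcomplete (Linf mu).
Proof.
move=> ma ta a0; pose F n : set_system T := [set A | \forall x \ae mu, a n x -> A x].
have mu0 : (0 < mu setT)%E.
  by apply: lt_le_trans (a0 0%N) _; apply: le_measure; rewrite ?inE.
have FF n : ProperFilter (F n).
  split.
    move=> F0; have : mu (a n) = 0%E.
      apply/negligibleP => //; apply: negligibleS F0 => x ax; exact.
    by move=> an0; have := a0 n; rewrite an0 ltxx.
  split.
  - by apply: aeW.
  - move=> A B; apply: (@filterS2 _ (almost_everywhere mu)) => x Ax Bx ax.
    by split; [exact: Ax|exact: Bx].
  - move=> A B AB; apply: (@filterS _ (almost_everywhere mu)) => x Ax ax.
    exact/AB/Ax.
have /choice[L LP] n := @filter_limit R _ (F n) (FF n).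
have bnd n (f : Loo) : F n [set x | `|f x| <= Loo_norm f].
  by have := Loo_norm_ae f mu0; apply: (@filterS _ (almost_everywhere mu)).
have Llin n (b : R) (f g : Loo) : L n (b *: f + g) = b * L n f + L n g.
  by have [h1 _ _] := LP n; exact: (h1 b f g _ _ (bnd n f) (bnd n g)).
have L0 n (f : Loo) : f \in @ae0_pred d T R mu -> L n f = 0.
  move=> /asboolP f0; have [_ _ h3] := LP n; apply: h3.
  by move: f0; apply: (@filterS _ (almost_everywhere mu)) => x /(_ I).
have Lrepr n (f : Loo) : L n (repr (\pi_(lmod_quot (@ae0_submod d T R mu))%qT f)) = L n f.
  have := Llin n 1 (repr (\pi_(lmod_quot (@ae0_submod d T R mu))%qT f) - f) f.
  rewrite scale1r subrK mul1r => ->; rewrite L0 ?add0r//; exact: repr_lmod_quot.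
apply: (operator_to_linf_no_overcomplete (@ltr01 R) (X := Linf mu)
  (phi := fun n q => L n (repr q))).
  move=> n; split=> [b x y|x].
    have <- : \pi_(lmod_quot (@ae0_submod d T R mu))%qT (b *: repr x + repr y) = b *: x + y.
      by rewrite raddfD /= pi_scale !reprK.
    by rewrite Lrepr Llin.
  rewrite mul1r -[x in leRHS]reprK Linf_normE.
  by have [_ h2 _] := LP n; exact: h2 (bnd n _).
move=> w; have [|f fE] := @Loo_of_bool (\bigcup_(n in [set n | w n]) a n).
  by apply: bigcup_measurable => n _; exact: ma.
exists (\pi_(lmod_quot (@ae0_submod d T R mu))%qT f) => n.
rewrite Lrepr; have [_ _ h3] := LP n; apply: h3; apply: (@aeW _ _ _ mu) => x ax /=.
rewrite fE; congr (_ _)%:R; apply/asboolP/idP => [[m /= wm amx]|wn]; last by exists n.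
by rewrite (ta n m)//; exists x.
Qed.

End essentially_bounded.

Lemma coin_Linf_no_overcomplete (R : realType) (I : choiceType) :
  infinite_set [set: I] -> ~ admits_overcomplete (Linf (coin_measure R I)).
Proof.
move=> /infiniteP/card_leTP[h hi].
pose s n := [seq h i | i <- iota 0 n.+1].
(* [a n] is the event that [h n] is the first true coordinate among [h 0], [h 1], and so on. These
   events are disjoint, of measure [2 ^- n.+1]. *)
pose a n : set (coin_space I) := [set x : I -> bool | {in s n, x =1 (fun i => i == h n)}].
have us n : uniq (s n) by rewrite map_inj_uniq// iota_uniq.
apply: (@Linf_no_overcomplete _ _ R (coin_measure R I) a).
- move=> n; apply: sub_sigma_algebra; exists (s n) => x y xy; apply/propext.
  by split=> xa i si; rewrite -?xa// ?xy//; rewrite -xy// xa.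
- have mem_s n m : (n <= m)%N -> h n \in s m.
    by move=> nm; apply: map_f; rewrite mem_iota add0n ltnS.
  move=> n m _ _ [x [xn xm]]; have [nm|nm] := leqP n m.
    have := xn _ (mem_s n n (leqnn n)); rewrite (xm _ (mem_s n m nm)) eqxx.
    by move=> /eqP/hi.
  have := xm _ (mem_s m m (leqnn m)); rewrite (xn _ (mem_s m n (ltnW nm))) eqxx.
  by move=> /eqP/hi.
- move=> n; rewrite [X in (0 < X)%E](coin_measure_cylinder R (fun i => i == h n) (us n)).
  by rewrite lte_fin invr_gt0 exprn_gt0.
Qed.

(** * The lattice Stone-Weierstrass theorem *)

Section stone_weierstrass.
Context {R : realType} {K : topologicalType} (cK : compact [set: K]).
Context {I : Type} (g : I -> K -> R) (gc : forall i, continuous (g i)).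
Hypothesis g_sep : forall x y, x <> y -> exists i, g i x <> g i y.

Lemma compact_finite_cover (U : K -> set K) : (forall x, nbhs x (U x)) ->
  exists s : seq K, forall z, exists2 x, x \in s & U x z.
Proof.
move=> Ux; apply: contrapT => ns.
pose G := filter_from [set: seq K] (fun s => [set z | forall x, x \in s -> ~ U x z]).
have FG : ProperFilter G.
  apply: filter_from_proper => [|s _].
    apply: filter_from_filter; first by exists [::].
    move=> s t _ _; exists (s ++ t) => // z zst.
    by split=> x xs; apply: zst; rewrite mem_cat xs ?orbT.
  apply: contrapT => nz; apply: ns; exists s => z; apply: contrapT => nx; apply: nz.
  by exists z => x xs Uxz; apply: nx; exists x.
have [|z [_ clz]] := cK FG; first by exists [::].
have [|y [nUy Uy]] := clz [set y | forall x, x \in [:: z] -> ~ U x y] (U z) _ (Ux z).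
  by exists [:: z].
by apply: nUy Uy; rewrite mem_head.
Qed.

(** Syntax is used so that the approximants can be counted; rational coefficients keep their number
    down to that of an infinite [I]. *)
Inductive lattice_term :=
| LVar of I
| LCst of rat
| LAdd of lattice_term & lattice_term
| LScale of rat & lattice_term
| LMax of lattice_term & lattice_term.

Fixpoint lattice_eval t x : R := match t with
  | LVar i => g i x
  | LCst q => ratr q
  | LAdd t u => lattice_eval t x + lattice_eval u x
  | LScale q t => ratr q * lattice_eval t x
  | LMax t u => Num.max (lattice_eval t x) (lattice_eval u x)
  end.

Lemma lattice_eval_continuous t : continuous (lattice_eval t).
Proof.
elim: t => [i|q|t iht u ihu|q t iht|t iht u ihu] x /=; first exact: gc.
- exact: cvg_cst.
- by apply: cvgD; [exact: iht|exact: ihu].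
- by apply: cvgMl_tmp; exact: iht.
- by apply: continuous_max; [exact: iht|exact: ihu].
Qed.

Fixpoint lattice_code t : seq (I + nat * rat) := match t with
  | LVar i => [:: inl i]
  | LCst q => [:: inr (0%N, q)]
  | LAdd t u => inr (1%N, 0) :: lattice_code t ++ lattice_code u
  | LScale q t => inr (2%N, q) :: lattice_code t
  | LMax t u => inr (3%N, 0) :: lattice_code t ++ lattice_code u
  end.

(** Unique readability of prefix notation; the remainders [l] and [l'] carry the induction through
    binary nodes. *)
Lemma lattice_code_prefix t u l l' : lattice_code t ++ l = lattice_code u ++ l' ->
  t = u /\ l = l'.
Proof.
elim: t u l l' => [i|q|t1 ih1 t2 ih2|q t ih|t1 ih1 t2 ih2] [j|r|u1 u2|r u|u1 u2] l l' //=.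
- by case=> -> ->.
- by case=> -> ->.
- by case; rewrite -!catA => /ih1[-> /ih2[-> ->]].
- by case=> -> /ih[-> ->].
- by case; rewrite -!catA => /ih1[-> /ih2[-> ->]].
Qed.

Lemma card_lattice_term : infinite_set [set: I] ->
  ([set: lattice_term] #<= [set: I])%card.
Proof.
move=> iI; apply: (@card_le_trans _ _ _ [set: seq (I + nat * rat)]).
  apply: (@card_le_funT _ _ lattice_code) => t u tu.
  have : lattice_code t ++ [::] = lattice_code u ++ [::] by rewrite !cats0.
  by case/lattice_code_prefix.
apply: card_seq_le => //.
have cI (J : countType) : ([set: J] #<= [set: I])%card.
  by apply: (@card_le_trans _ _ _ [set: nat]); [exact: countableP|exact/infiniteP].
have [i0 _] := infinite_setN0 iI.
pose f (t : I + nat * rat) : bool * (nat * rat) * I :=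
  match t with inl i => (true, (0%N, 0), i) | inr p => (false, p, i0) end.
apply: (@card_le_trans _ _ _ [set: bool * (nat * rat) * I]).
  by apply: (@card_le_funT _ _ f) => -[i|p] [j|q] //= [] => [->|->].
rewrite -setXTT; apply: card_prod_le => //; exact: cI.
Qed.

Let rat_near (x e : R) : 0 < e -> exists q : rat, `|x - ratr q| < e.
Proof.
move=> e0; have : x < x + e by rewrite ltrDl.
move=> /rat_in_itvoo[q]; rewrite in_itv/= => /andP[xq qx]; exists q.
by rewrite ltr0_norm ?subr_lt0// opprB ltrBlDr addrC.
Qed.

Let two_point (f : K -> R) (e : R) x y : 0 < e -> exists t,
  `|f x - lattice_eval t x| < e /\ `|f y - lattice_eval t y| < e.
Proof.
move=> e0; have [->|xy] := pselect (x = y).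
  by have [q qP] := rat_near (f y) e0; exists (LCst q).
have [i gi] := g_sep xy.
have gxy : g i x - g i y != 0 by rewrite subr_eq0; exact/eqP.
(* [c + r * g i] interpolates [f] at [x] and [y]. The sum in [M0] bounds [g i] at both points, so
   rounding [c] and [r] costs [e / 2] each. *)
pose r := (f x - f y) / (g i x - g i y); pose c := f x - r * g i x.
have e20 : 0 < e / 2 by rewrite divr_gt0.
have M0 : 0 < `|g i x| + `|g i y| + 1 by rewrite ltr_wpDl// addr_ge0.
have [q qP] := rat_near c e20.
have [s sP] := rat_near r (divr_gt0 e20 M0).
exists (LAdd (LCst q) (LScale s (LVar i))) => /=.
have near z : f z = c + r * g i z -> `|g i z| <= `|g i x| + `|g i y| + 1 ->
    `|f z - (ratr q + ratr s * g i z)| < e.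
  move=> -> zM; rewrite opprD addrACA -mulrBl (le_lt_trans (ler_normD _ _))//.
  rewrite [ltRHS]splitr ltr_leD// normrM.
  apply: (@le_trans _ _ (e / 2 / (`|g i x| + `|g i y| + 1) * (`|g i x| + `|g i y| + 1))).
    by apply: ler_pM => //; exact: ltW.
  by rewrite divfK ?gt_eqF.
split; apply: near.
- by rewrite /c subrK.
- by rewrite -addrA lerDl addr_ge0.
- have : r * (g i x - g i y) = f x - f y by rewrite /r divfK.
  rewrite mulrBr => rE; apply/eqP; rewrite -subr_eq0; apply/eqP.
  by rewrite /c addrAC -(subrK (f y) (f x)) -rE; ring.
- by rewrite addrAC lerDr addr_ge0.
Qed.

Let max_terms (s : seq lattice_term) t : exists u, forall x,
  lattice_eval u x = \big[Num.max/lattice_eval t x]_(v <- s) lattice_eval v x.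
Proof.
elim: s => [|v s [u uP]]; first by exists t => x; rewrite big_nil.
by exists (LMax v u) => x; rewrite big_cons /= uP.
Qed.

(** For each [x], a maximum of finitely many two-point approximants lies above [f - e] everywhere
    and close to [f] at [x]. A minimum of finitely many of these, written as a negated maximum of
    negatives, lies below [f + e] as well. *)
Lemma lattice_stone_weierstrass (f : K -> R) (e : R) : continuous f -> 0 < e ->
  exists t, forall x, `|f x - lattice_eval t x| < e.
Proof.
move=> fc e0.
have diff_c t : continuous (fun z => f z - lattice_eval t z).
  by move=> z; apply: cvgB; [exact: fc|exact: lattice_eval_continuous].
have open_lt_diff t : open [set z | f z - lattice_eval t z < e].
  exact: (open_comp (fun z _ => diff_c t z) (@open_lt R e)).
have open_gt_diff t : open [set z | - e < f z - lattice_eval t z].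
  exact: (open_comp (fun z _ => diff_c t z) (@open_gt R (- e))).
have upper x : exists t, `|f x - lattice_eval t x| < e /\ forall z, f z - lattice_eval t z < e.
  have /choice[t tP] y := two_point f x y e0.
  have [|s sP] := @compact_finite_cover (fun y => [set z | f z - lattice_eval (t y) z < e]).
    move=> y; apply: open_nbhs_nbhs; split => //=.
    by have [_ /(le_lt_trans (ler_norm _))] := tP y.
  have [u uP] := max_terms [seq t y | y <- s] (t x).
  exists u; split=> [|z].
    rewrite uP big_map; elim/big_rec : _ => [|y a _ ih]; first exact: (tP x).1.
    by case: (leP (lattice_eval (t y) x) a) => _ //; exact: (tP y).1.
  have [y ys yz] := sP z; rewrite (le_lt_trans _ yz)// lerD2l lerN2 uP big_map.
  elim: s ys {sP uP} => // y' s ih; rewrite inE big_cons le_max => /predU1P[->|/ih ->].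
    by rewrite lexx.
  by rewrite orbT.
have /choice[t tP] := upper.
have [|s sP] := @compact_finite_cover (fun x => [set z | - e < f z - lattice_eval (t x) z]).
  move=> x; apply: open_nbhs_nbhs; split => //=.
  by have [+ _] := tP x; rewrite ltr_norml => /andP[].
(* An empty cover means that [K] is empty, and any term will do. *)
case: s sP => [sP|x0 s sP].
  by exists (LCst 0) => x; have [] := sP x.
pose neg u := LScale (-1) u.
have negE u x : lattice_eval (neg u) x = - lattice_eval u x.
  by rewrite /= rmorphN1 mulN1r.
have [u uP] := max_terms [seq neg (t y) | y <- s] (neg (t x0)).
exists (neg u) => z; rewrite negE opprK uP big_map.
have -> : f z + \big[Num.max/lattice_eval (neg (t x0)) z]_(v <- s) lattice_eval (neg (t v)) z =
    \big[Num.max/f z - lattice_eval (t x0) z]_(v <- s) (f z - lattice_eval (t v) z).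
  elim: s {sP uP} => [|v s ih]; first by rewrite !big_nil negE.
  by rewrite !big_cons -ih addr_maxr negE.
rewrite ltr_norml; apply/andP; split.
  have [y + yz] := sP z; rewrite inE; elim: s {sP uP} => [|v s ih].
    by rewrite big_nil orbF => /eqP <-.
  rewrite big_cons inE lt_max => /orP[/eqP yx0|/orP[/eqP yv|ys]].
  - by rewrite ih ?orbT// yx0 eqxx.
  - by rewrite -yv yz.
  - by rewrite ih ?ys ?orbT.
elim/big_rec : _ => [|y a _ ih]; first exact: (tP x0).2.
by rewrite gt_max (tP y).2.
Qed.

End stone_weierstrass.

(** * Continuous functions on cubes *)

Section cubes.
Local Open Scope card_scope.
Context {R : realType} {K : topologicalType} (cK : compact [set: K]).
Context {I : choiceType} (g : I -> K -> R) (gc : forall i, continuous (g i)).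
Hypothesis g_sep : forall x y, x <> y -> exists i, g i x <> g i y.
Hypothesis g_indep : forall s : I -> bool, exists x, forall i, g i x = (s i)%:R.
Hypothesis iI : infinite_set [set: I].

Local Notation X := (cspace R cK).

Lemma cspace_le (f : X) M : 0 <= M -> (forall x, `|val f x| <= M) -> `|f| <= M.
Proof. by move=> M0 fM; rewrite cspace_normE; exact: sup_norm_le. Qed.

Lemma cspace_ub (f : X) x : `|val f x| <= `|f|.
Proof. by rewrite cspace_normE; exact/sup_norm_ub/cspace_bounded. Qed.

(** Lattice terms in the coordinates give a dense set no larger than [I]. Conversely the coordinates
    are at mutual distance at least 1, so a dense set contains different points within 1/2 of
    each. *)
Lemma cspace_density (Y : Type) (A : set Y) : has_density X A -> A #= [set: I].
Proof.
move=> [[D dD DA] Amin]; apply/card_eqPle; split.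
  pose d t : X := cspace_of cK (@lattice_eval_continuous R K I g gc t).
  apply: (@card_le_trans _ _ _ (range d)); last first.
    by apply: (card_le_trans (card_image_le _ _)); exact: card_lattice_term.
  apply: Amin => U [f Uf] oU; have /nbhs_ballP[r /= r0 rU] := open_nbhs_nbhs (conj oU Uf).
  have cf : continuous (val f) by apply/asboolP; exact: (valP f).
  have [t tP] := lattice_stone_weierstrass cK gc g_sep cf (divr_gt0 r0 (ltr0n R 2)).
  exists (d t); split; last by exists t.
  apply: rU; rewrite -ball_normE /=; apply: (@le_lt_trans _ _ (r / 2)).
    by apply: cspace_le => [|x]; [rewrite ltW// divr_gt0|exact: ltW (tP x)].
  by rewrite ltr_pdivrMr// ltr_pMr// ltr1n.
rewrite -(card_le_eqr DA).
pose e i : X := cspace_of cK (@gc i).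
apply: (@card_le_choice _ _ _ _ (fun i f => `|e i - f| < 2^-1)) => [i _|i j f _ _ fi fj].
  have h0 : 0 < 2^-1 :> R by rewrite invr_gt0.
  have [|v [ev Dv]] := dD (ball (e i) 2^-1) _ (ball_open (e i) 2^-1).
    by exists (e i); exact: ballxx.
  by exists v => //; move: ev; rewrite -ball_normE.
apply: contrapT => /eqP ij; have [x xP] := g_indep (fun j => j == i).
have : `|e i - e j| < 1.
  rewrite -(subrK f (e i)) -addrA (le_lt_trans (ler_normD _ _))//.
  rewrite [ltRHS](_ : _ = 2^-1 + 2^-1); last by field.
  by rewrite ltrD// distrC.
move/(le_lt_trans (cspace_ub _ x)).
rewrite [X in `|X|](_ : _ = g i x - g j x)// !xP eqxx eq_sym (negbTE ij).
by rewrite subr0 normr1 ltxx.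
Qed.

Theorem cspace_cube_no_overcomplete : uncountable_cofinality I ->
  ~ admits_overcomplete X.
Proof.
move=> cofI; have [/card_leTP[j ji]|/card_leTP[j ji]] := card_le_total [set: I] [set: nat -> bool].
  move=> [Y [YX Yd]].
  have [|Z [ZY Zc]] := small_nondense_subset (X := X) ji iI
      (fun f => uncountable_cofinality_pigeonhole f cofI)
      (e := fun i => cspace_of cK (@gc i)) (@ltr01 R) _ (cspace_density YX).
    move=> F s; have [x xP] := g_indep s.
    by exists (fun f : X => val f x) => [|i _]; [exact: cspace_eval_dual_ball|exact: xP].
  by apply; exact: Yd.
have /choice[v vP] (i : I) : exists w : nat -> bool, forall u, j u = i -> w = u.
  have [[u ui]|nu] := pselect (exists u, j u = i).
    by exists u => u'; rewrite -ui => /ji.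
  by exists (fun=> true) => u ui; case: nu; exists u.
(* Evaluations at the points [p n] serve as functionals: the coordinate of index [j w] takes the
   value [w n] at [p n]. *)
have /choice[p pP] n := g_indep (fun i => v i n).
apply: (operator_to_linf_no_overcomplete (@ltr01 R) (X := X)
  (phi := fun n (f : X) => val f (p n))).
  by move=> n; exact: cspace_eval_dual_ball.
by move=> w; exists (cspace_of cK (@gc (j w))) => n; rewrite /= pP (vP _ w).
Qed.

End cubes.

Lemma tychonoff_cube_no_overcomplete (R : realType) (I : choiceType) :
  uncountable_cofinality I ->
  ~ admits_overcomplete (cspace R (tychonoff_cube_compact R I)).
Proof.
move=> cofI; pose g (i : I) (x : tychonoff_cube R I) : R := val (x i).
apply: (@cspace_cube_no_overcomplete _ _ _ _ g) => //.
- move=> i x; apply: (@continuous_comp _ _ _ (fun x : tychonoff_cube R I => x i) val).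
    exact: (@proj_continuous I (fun=> unit_interval R) i).
  exact: initial_continuous.
- move=> x y xy; apply: contrapT => ng; apply: xy; apply/funext => i; apply: val_inj.
  by apply: contrapT => gi; apply: ng; exists i.
- move=> s.
  have s01 i : `[0 : R, 1]%classic (s i)%:R.
    by rewrite /= in_itv/=; case: (s i); rewrite ?lexx ?ler01.
  by exists (fun i => SigSub (mem_set (s01 i))).
- exact: uncountable_cofinality_infinite.
Qed.

Lemma cantor_cube_no_overcomplete (R : realType) (I : choiceType) :
  uncountable_cofinality I ->
  ~ admits_overcomplete (cspace R (cantor_cube_compact I)).
Proof.
move=> cofI; pose g (i : I) (x : cantor_cube I) : R := (x i)%:R.
apply: (@cspace_cube_no_overcomplete _ _ _ _ g) => //.
- move=> i x; apply: (@continuous_comp (cantor_cube I) bool R (fun x => x i) (fun b : bool => b%:R)).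
    exact: (@proj_continuous I (fun=> bool) i).
  apply: cvg_near_cst.
  suff : nbhs (x i) [set b : bool | b%:R = (x i)%:R :> R] by [].
  by rewrite nbhs_principalE; exact/principal_filterP.
- move=> x y xy; apply: contrapT => ng; apply: xy; apply/funext => i.
  apply: contrapT => gi; apply: ng; exists i; rewrite /g.
  by case: (x i) (y i) gi => -[] // _; apply/eqP; rewrite ?oner_eq0// eq_sym oner_eq0.
- by move=> s; exists s.
- exact: uncountable_cofinality_infinite.
Qed.

Theorem theorem29 (R : realType) :
  [/\ forall (kappa : choiceType) (X : completeNormedModType R),
        uncountable_cofinality kappa ->
        infinite_dimensional X ->
        has_density X [set: kappa] ->
        contains_copy (l1 R kappa) X ->
        ~ admits_overcomplete X,
      forall (K : topologicalType) (cK : compact [set: K]),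
        hausdorff_space K -> extremally_disconnected K ->
        infinite_set [set: K] ->
        ~ admits_overcomplete (cspace R cK),
      forall lambda : choiceType, infinite_set [set: lambda] ->
        [/\ ~ admits_overcomplete (linf R lambda),
            ~ admits_overcomplete (linf_mod_c0 R lambda) &
            ~ admits_overcomplete (Linf (coin_measure R lambda))]
    & forall kappa : choiceType, uncountable_cofinality kappa ->
        ~ admits_overcomplete (cspace R (tychonoff_cube_compact R kappa)) /\
        ~ admits_overcomplete (cspace R (cantor_cube_compact kappa))].
Proof.
split.
- by move=> kappa X cof _ dens copy; exact: l1_copy_no_overcomplete cof dens copy.
- by move=> K cK hK eK iK; exact: extremally_disconnected_no_overcomplete.
- move=> lambda ilambda; split.
  + exact: linf_no_overcomplete.
  + exact: linf_mod_c0_no_overcomplete.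
  + exact: coin_Linf_no_overcomplete.
- move=> kappa cof; split.
  + exact: tychonoff_cube_no_overcomplete.
  + exact: cantor_cube_no_overcomplete.
Qed.
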